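(* Let $T^n=\mathbb{R}^n/\Lambda_n$ be a flat torus with the metric $du_1^2+\dots+du_n^2$, and let $x:T^n\to\mathbb{S}^m$ be a linearly full isometric minimal immersion. Let $\xi_1,\dots,\xi_N$ be all the vectors, up to sign, of the dual lattice $\Lambda_n^*$ with $4\pi^2|\xi|^2=n$ (so that the eigenspace of $T^n$ for the eigenvalue $n$ has dimension $2N$). If $\{\xi_1,\dots,\xi_N\}$ satisfies the unimodular condition, then $m$ is odd and $x$ is homogeneous.
   Context: The dual lattice is $\Lambda_n^*=\{\xi\in\mathbb{R}^n:\langle\xi,v\rangle\in\mathbb{Z}\ \forall v\in\Lambda_n\}$. A finite set $V\subset\mathbb{R}^n$ of rank $k$ satisfies the unimodular condition if all $k$-dimensional (nondegenerate) parallelepipeds spanned by $k$ vectors of $V$ have the same $k$-volume. Linearly full means the image is not contained in a proper linear subspace of $\mathbb{R}^{m+1}$. Homogeneous means that the image of $x$ is an orbit of a torus subgroup of the orthogonal group; concretely, up to an orthogonal transformation, $x(u)=(c_je^{2\pi i\langle\xi_j,u\rangle})_{j}$ with constants $c_j>0$, where $j$ runs over a subset of $\{1,\dots,N\}$. *)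

(* Defs.v *)
From HB Require Import structures.
From mathcomp Require Import all_boot all_order all_algebra.
From mathcomp Require Import all_classical all_reals all_analysis.

Set Implicit Arguments.
Unset Strict Implicit.
Unset Printing Implicit Defensive.

Import Order.TTheory GRing.Theory Num.Theory.
Import numFieldNormedType.Exports.

Local Open Scope classical_set_scope.
Local Open Scope ring_scope.

(** Vectors of R^n are row vectors; matrices act on the right. *)

Section Lattices.
Context {R : realType} {n : nat}.
Implicit Types (u v xi : 'rV[R]_n) (Lam : set 'rV[R]_n).

Definition dotv u v : R := \sum_i u 0 i * v 0 i.

(* The rows of B are a basis of R^n generating the lattice. *)
Definition is_lattice Lam : Prop :=
  exists2 B : 'M[R]_n, B \in unitmx &
    Lam = [set (map_mx (fun k : int => k%:~R) z : 'rV[R]_n) *m B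
          | z in [set: 'rV[int]_n]].

Definition dual_lattice Lam : set 'rV[R]_n :=
  [set xi | forall v, Lam v -> dotv xi v \is a Num.int].

(* The dual vectors of the eigenfunctions exp (2 i pi <xi, u>) of the
   Laplacian of R^n / Lam for the eigenvalue n. *)
Definition eigen_covector Lam xi : Prop :=
  dual_lattice Lam xi /\ 4 * pi ^+ 2 * dotv xi xi = n%:R.

(* Uniqueness of j says that no two members of the family are equal or
   opposite. *)
Definition enumerates_up_to_sign (A : set 'rV[R]_n) (N : nat)
    (xi : 'I_N -> 'rV[R]_n) : Prop :=
  (forall j, A (xi j)) /\
  (forall eta, A eta -> exists! j, eta = xi j \/ eta = - xi j).

(* k-volume of the parallelepiped spanned by the rows of M, by the Gram
   determinant. *)
Definition volume (k : nat) (M : 'M[R]_(k, n)) : R :=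
  Num.sqrt (\det (M *m M^T)).

Definition unimodular (N : nat) (V : 'I_N -> 'rV[R]_n) : Prop :=
  let k := \rank (\matrix_(j < N) V j) in
  forall s t : 'I_k -> 'I_N,
    row_free (\matrix_(i < k) V (s i)) ->
    row_free (\matrix_(i < k) V (t i)) ->
    volume (\matrix_(i < k) V (s i)) = volume (\matrix_(i < k) V (t i)).

End Lattices.

Section Immersions.
Context {R : realType} {n p : nat}.
Implicit Types (x : 'rV[R]_n -> 'rV[R]_p) (u : 'rV[R]_n).

Fixpoint Ck (k : nat) (x : 'rV[R]_n -> 'rV[R]_p) : Prop :=
  if k is k'.+1 then
    (forall u, differentiable x u) /\ (forall v, Ck k' (fun u => 'D_v x u))
  else continuous x.

Definition smooth x : Prop := forall k, Ck k x.

Definition lattice_periodic (Lam : set 'rV[R]_n) x : Prop :=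
  forall u v, Lam v -> x (u + v) = x u.

Definition in_sphere x : Prop := forall u, dotv (x u) (x u) = 1.

Definition induced_metric x u : 'M[R]_n := 'J x u *m ('J x u)^T.

(* The domain carries the metric du_1^2 + ... + du_n^2. *)
Definition isometric x : Prop := forall u, induced_metric x u = 1%:M.

(* Component of y orthogonal to the position vector x u and to the tangent
   space, which is the row space of the Jacobian; x is an immersion into the
   unit sphere, so x u is a unit vector orthogonal to the tangent space. *)
Definition normal_part x u (y : 'rV[R]_p) : 'rV[R]_p :=
  y - dotv y (x u) *: x u
    - y *m ('J x u)^T *m invmx (induced_metric x u) *m 'J x u.

(* Second fundamental form of x in the unit sphere, on the coordinate fields. *)
Definition second_form x u (i j : 'I_n) : 'rV[R]_p :=
  normal_part x u
    ('D_(delta_mx 0 i) (fun w => 'D_(delta_mx 0 j) x w) u).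

Definition mean_curvature x u : 'rV[R]_p :=
  n%:R^-1 *: \sum_i \sum_j invmx (induced_metric x u) i j *: second_form x u i j.

Definition minimal x : Prop := forall u, mean_curvature x u = 0.

(* Linear subspaces of R^p are the row spaces of the p x p matrices. *)
Definition linearly_full x : Prop :=
  forall W : 'M[R]_p, (forall u, (x u <= W)%MS) -> row_full W.

End Immersions.

Section Homogeneity.
Context {R : realType} {n p : nat}.

(* A torus in the orthogonal group: a compact connected abelian subgroup. *)
Record torus_subgroup (G : set 'M[R]_p) : Prop := {
  torus_orthogonal : forall g, G g -> g *m g^T = 1%:M;
  torus_one : G 1%:M;
  torus_mul : forall g h, G g -> G h -> G (g *m h);
  torus_inv : forall g, G g -> G (invmx g);
  torus_comm : forall g h, G g -> G h -> g *m h = h *m g;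
  torus_compact : compact G;
  torus_connected : connected G }.

Definition homogeneous (x : 'rV[R]_n -> 'rV[R]_p) : Prop :=
  exists2 G : set 'M[R]_p, torus_subgroup G &
    exists y : 'rV[R]_p, range x = [set y *m g | g in G].

(* The map u |-> (c_j exp (2 i pi <xi_j, u>))_(j in J) to C^#|J|, which is
   identified with R^(#|J| + #|J|): real parts first, then imaginary parts. *)
Definition exp_map (N : nat) (xi : 'I_N -> 'rV[R]_n) (J : {set 'I_N})
    (c : 'I_N -> R) (u : 'rV[R]_n) : 'rV[R]_(#|J| + #|J|) :=
  let theta j := 2 * pi * dotv (xi j) u in
  row_mx (\row_(k < #|J|) (c (enum_val k) * cos (theta (enum_val k))))
         (\row_(k < #|J|) (c (enum_val k) * sin (theta (enum_val k)))).

(* The conditions on Q make it an isometry of R^(#|J| + #|J|) onto R^p, and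
   force #|J| + #|J| = p. *)
Definition homogeneous_form (N : nat) (xi : 'I_N -> 'rV[R]_n)
    (x : 'rV[R]_n -> 'rV[R]_p) : Prop :=
  exists (J : {set 'I_N}) (c : 'I_N -> R) (Q : 'M[R]_(#|J| + #|J|, p)),
    [/\ forall j, j \in J -> 0 < c j,
        Q *m Q^T = 1%:M,
        Q^T *m Q = 1%:M &
        forall u, x u = exp_map xi J c u *m Q].

End Homogeneity.

(* Main.v *)
Require Import Defs.
From HB Require Import structures.
From mathcomp Require Import all_boot all_order all_algebra.
From mathcomp Require Import all_classical all_reals all_analysis.
From mathcomp Require Import ring lra.

Set Implicit Arguments.
Unset Strict Implicit.
Unset Printing Implicit Defensive.

Import Order.TTheory GRing.Theory Num.Theory.
Import numFieldNormedType.Exports.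

Local Open Scope classical_set_scope.
Local Open Scope ring_scope.

(** By Takahashi's theorem minimality means [Delta x = - n x], so the Fourier
    coefficients of [x] are supported on the vectors [+- xi_j]:
    [x = sum_eta Z_eta e^(2 i pi <eta, u>)].  Fourier coefficients are taken
    with respect to an ultrafilter limit of averages over the grids
    [2^-r Lambda]; a continuous periodic function with vanishing coefficients
    is zero, by testing it against powers of a trigonometric polynomial peaking
    at one point.

    Constancy of [<D_v x, D_w x>] gives, for every [omega <> 0],
    [sum_(eta + eta' = omega) <eta, w> <eta', v> (Z_eta . Z_eta') = 0]
    for the complex bilinear dot product.  Given a pair [eta1 + eta2 = omega],
    extend [eta1, eta2] to a basis, first by members [eta] of pairs with the
    same sum, then by arbitrary [+- xi_j].  Unimodularity forces the coordinates
    of the [+- xi_j] to be 0 or +-1 in this basis and in each basis obtained by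
    replacing such an [eta] by [omega - eta]; choosing [w], [v] dual to [eta1],
    [eta2], this leaves only the term of the pair itself.  So
    [Z_eta . Z_eta' = 0] unless [eta' = - eta], which says that the real and
    imaginary parts of the [Z_(xi_j)] are orthogonal of equal norms.  Those that
    do not vanish form, after normalisation, an orthonormal basis of [R^(m+1)]
    by linear fullness, in which [x] is the map of the statement. *)

(** * Grid averages and an invariant mean *)

Section GridMean.
Context {R : realType} {n : nat}.
Variable B : 'M[R]_n.
Implicit Types (phi psi : 'rV[R]_n -> R) (u v : 'rV[R]_n).

Definition bdd phi : Prop := exists C, forall u, `|phi u| <= C.

Definition latv (z : 'rV[int]_n) : 'rV[R]_n :=
  (map_mx (fun k : int => k%:~R) z : 'rV[R]_n) *m B.

(** Indices live in ['I_K.+1], where addition is modulo [K.+1], so that shifting the grid is a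
    bijective reindexing by a group element. *)
Definition gridpt (K : nat) (t : 'rV['I_K.+1]_n) : 'rV[R]_n :=
  (\row_i ((t 0 i : nat)%:R / K.+1%:R)) *m B.

Definition grid_avg (K : nat) phi : R :=
  (#|{: 'rV['I_K.+1]_n}|%:R)^-1 * \sum_(t : 'rV['I_K.+1]_n) phi (gridpt t).

Lemma card_grid_neq0 K : (#|{: 'rV['I_K.+1]_n}|%:R : R) != 0.
Proof. by rewrite pnatr_eq0 -lt0n; apply/card_gt0P; exists 0. Qed.

Lemma grid_avgD K phi psi :
  grid_avg K (fun u => phi u + psi u) = grid_avg K phi + grid_avg K psi.
Proof. by rewrite /grid_avg big_split mulrDr. Qed.

Lemma grid_avgZ K a phi :
  grid_avg K (fun u => a * phi u) = a * grid_avg K phi.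
Proof. by rewrite /grid_avg -mulr_sumr mulrCA. Qed.

Lemma grid_avg_cst K a : grid_avg K (fun=> a) = a.
Proof.
rewrite /grid_avg sumr_const -[X in _ * X]mulr_natl mulrA mulVf ?mul1r//.
exact: card_grid_neq0.
Qed.

Lemma grid_avg_le K phi psi :
  (forall u, phi u <= psi u) -> grid_avg K phi <= grid_avg K psi.
Proof.
by move=> h; rewrite /grid_avg ler_wpM2l ?invr_ge0 ?ler0n// ler_sum.
Qed.

(** Coordinatewise Euclidean division by [K.+1]: remainders give the new grid index, and the carries
    together with the quotients of [z] form the lattice vector [z']. *)
Lemma gridpt_shift K (t : 'rV['I_K.+1]_n) (z : 'rV[int]_n) :
  exists z' : 'rV[int]_n,
    gridpt t + K.+1%:R^-1 *: latv z =
    gridpt (t + map_mx (fun k => inord (absz (k %% K.+1)%Z)) z) + latv z'.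
Proof.
exists (\row_i (((t ord0 i : nat) + `|(z ord0 i %% K.+1)%Z|) %/ K.+1)%N%:Z
        + map_mx (fun k => (k %/ K.+1)%Z) z).
rewrite /gridpt /latv scalemxAl -!mulmxDl; congr (_ *m B).
apply/rowP => i; rewrite !mxE /=.
set a := inord _; have aE : (a : nat) = `|(z ord0 i %% K.+1)%Z|%N.
  rewrite /a inordK// -ltz_nat gez0_abs ?modz_ge0//.
  exact: ltz_pmod.
have zE : (z 0 i)%:~R = (z ord0 i %/ K.+1)%Z%:~R * K.+1%:R + (a : nat)%:R :> R.
  rewrite {1}(divz_eq (z ord0 i) K.+1) rmorphD rmorphM /= aE.
  by rewrite -(pmulrn 1 K.+1) (pmulrn 1 `|_|%N) gez0_abs ?modz_ge0.
have tE : (t 0 i : nat)%:R + (a : nat)%:R =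
   (((t ord0 i : nat) + a) %/ K.+1)%N%:R * K.+1%:R
     + ((t ord0 i + a) %% K.+1)%N%:R :> R.
  by rewrite -natrD {1}(divn_eq (t ord0 i + a)%N K.+1) natrD natrM.
have K0 : K.+1%:R != 0 :> R by rewrite pnatr_eq0.
rewrite rmorphD /= zE -aE -(pmulrn 1 (_ %/ _)%N).
rewrite -[X in X / _](addrK (a : nat)%:R) tE.
by rewrite /=; field.
Qed.

Lemma grid_avg_shift K phi (z : 'rV[int]_n) :
  (forall u w, phi (u + latv w) = phi u) ->
  grid_avg K (fun u => phi (u + K.+1%:R^-1 *: latv z)) = grid_avg K phi.
Proof.
move=> per; rewrite /grid_avg; congr (_ * _).
pose s : 'rV['I_K.+1]_n := map_mx (fun k => inord `|(k %% K.+1)%Z|%N) z.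
rewrite [RHS](reindex (fun t => t + s)) /=; last first.
  by exists (fun t => t - s) => t _; rewrite ?addrK ?subrK.
apply: eq_bigr => t _; have [z' ->] := gridpt_shift t z.
by rewrite per.
Qed.

End GridMean.

Section Mean.
Context {R : realType} {n : nat}.
Variable B : 'M[R]_n.
Implicit Types (phi psi : 'rV[R]_n -> R) (u v : 'rV[R]_n).

Definition lattice_per (T : Type) (f : 'rV[R]_n -> T) : Prop :=
  forall u z, f (u + latv B z) = f u.

(* Invariance is only asked for dyadic fractions of lattice vectors: this is
   what grids of mesh 2^-r provide, and it suffices for integration by parts. *)
Record is_mean (J : ('rV[R]_n -> R) -> R) : Prop := {
  meanD : forall phi psi, bdd phi -> bdd psi ->
    J (fun u => phi u + psi u) = J phi + J psi;
  meanZ : forall a phi, bdd phi -> J (fun u => a * phi u) = a * J phi;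
  mean_le : forall phi psi, bdd phi -> bdd psi ->
    (forall u, phi u <= psi u) -> J phi <= J psi;
  mean_cst : forall a, J (fun=> a) = a;
  mean_shift : forall phi (s : nat) z, bdd phi -> lattice_per phi ->
    J (fun u => phi (u + (2 ^+ s)^-1 *: latv B z)) = J phi }.

Lemma ultra_image_filter (S T : Type) (U : set_system S) (f : S -> T) :
  UltraFilter U -> UltraFilter (f @ U).
Proof.
move=> UU; split=> [|G PG sUG]; first exact: fmap_proper_filter.
apply/seteqP; split=> // A GA.
have [//|UcA] := in_ultra_setVsetC (f @^-1` A) UU.
have GcA : G (~` A) by exact: sUG.
by have [x []] := filter_ex (filterI GA GcA).
Qed.

(** An ultrafilter living on the compact segment [[-C, C]] converges. Averages of any bounded
    function thus have a limit, with no integrability to check. *)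
Lemma ultra_bounded_cvg (U : set_system nat) (f : nat -> R) (C : R) :
  UltraFilter U -> (forall r, `|f r| <= C) -> cvg (f @ U).
Proof.
move=> UU fC.
have UfU : UltraFilter (f @ U) by exact: ultra_image_filter.
have := @segment_compact R (- C) C; rewrite compact_ultra => /(_ _ UfU).
case.
  by rewrite /fmap /=; apply: filterE => r /=; rewrite in_itv /= -ler_norml.
by move=> l [_ fl]; apply/cvg_ex; exists l.
Qed.

Lemma exists_mean : exists J, is_mean J.
Proof.
have [U [UU ooU]] := @ultraFilterLemma nat \oo _.
(* The predecessor compensates the successor in [grid_avg]: these grids have [2 ^ r] points in each
   direction. *)
pose f phi r := grid_avg B (2 ^ r).-1 phi.
have fcvg phi : bdd phi -> cvg (f phi @ U).
  move=> [C phiC]; apply: (@ultra_bounded_cvg U _ C) => // r.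
  rewrite /f ler_norml; apply/andP; split.
    rewrite -(grid_avg_cst B (2 ^ r).-1 (- C)); apply: grid_avg_le => u.
    by have := phiC u; rewrite ler_norml => /andP[].
  rewrite -[leRHS](grid_avg_cst B (2 ^ r).-1 C); apply: grid_avg_le => u.
  by have := phiC u; rewrite ler_norml => /andP[].
exists (fun phi => lim (f phi @ U)); split.
- move=> phi psi bphi bpsi; apply: cvg_lim => //.
  rewrite (_ : f _ = (fun r => f phi r + f psi r)); last first.
    by apply/funext => r; rewrite /f grid_avgD.
  by apply: cvgD; [exact: fcvg bphi|exact: fcvg bpsi].
- move=> a phi bphi; apply: cvg_lim => //.
  rewrite (_ : f _ = (fun r => a * f phi r)); last first.
    by apply/funext => r; rewrite /f grid_avgZ.
  by apply: cvgMl_tmp; exact: fcvg bphi.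
- move=> phi psi bphi bpsi le_phi_psi; apply: ler_lim; first exact: fcvg.
    exact: fcvg.
  by apply: nearW => r; exact: grid_avg_le.
- move=> a; apply: cvg_lim => //.
  rewrite (_ : f _ = (fun=> a)); first exact: cvg_cst.
  by apply/funext => r; rewrite /f grid_avg_cst.
- move=> phi s z bphi per; apply: cvg_lim => //.
  apply: cvg_trans (fcvg _ bphi); apply: near_eq_cvg.
  (* From rank [s] on, the shift by [2^-s z] is the shift by [2^-r (2^(r-s) z)], which permutes the
     grid of mesh [2^-r] modulo the lattice; the two averages are then equal. *)
  apply: ooU; exists s => // r /= sr.
  rewrite /f -[in LHS](grid_avg_shift _ (map_mx (fun k => (2 ^ (r - s))%N%:Z * k) z) per).
  congr grid_avg; apply/funext => u; congr (phi (_ + _)).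
  rewrite prednK ?expn_gt0// /latv !scalemxAl; congr (_ *m B).
  apply/rowP => i; rewrite !mxE rmorphM /= mulrA; congr (_ * _).
  rewrite -(pmulrn 1) -[in LHS](subnK sr) expnD natrM invfM.
  have e0 k : (2 : R) ^+ k != 0 by rewrite expf_neq0// pnatr_eq0.
  by rewrite !natrX addnK; field; rewrite !e0.
Qed.

End Mean.

(** * Euclidean and trigonometric preliminaries *)

Section Dot.
Context {R : realType} {n : nat}.
Implicit Types u v w : 'rV[R]_n.

Lemma dotvC u v : dotv u v = dotv v u.
Proof. by apply: eq_bigr => i _; rewrite mulrC. Qed.

Lemma dotvDl u v w : dotv (u + v) w = dotv u w + dotv v w.
Proof. by rewrite /dotv -big_split; apply: eq_bigr => i _; rewrite mxE mulrDl. Qed.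

Lemma dotvZl a u v : dotv (a *: u) v = a * dotv u v.
Proof. by rewrite /dotv mulr_sumr; apply: eq_bigr => i _; rewrite mxE mulrA. Qed.

Lemma dotvDr u v w : dotv u (v + w) = dotv u v + dotv u w.
Proof. by rewrite dotvC dotvDl !(dotvC u). Qed.

Lemma dotvZr a u v : dotv u (a *: v) = a * dotv u v.
Proof. by rewrite dotvC dotvZl dotvC. Qed.

Lemma dotvNl u v : dotv (- u) v = - dotv u v.
Proof. by rewrite -scaleN1r dotvZl mulN1r. Qed.

Lemma dotvNr u v : dotv u (- v) = - dotv u v.
Proof. by rewrite dotvC dotvNl dotvC. Qed.

Lemma dotv0l u : dotv 0 u = 0.
Proof. by rewrite -(scale0r 0) dotvZl mul0r. Qed.

Lemma dotv0r u : dotv u 0 = 0.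
Proof. by rewrite dotvC dotv0l. Qed.

Lemma dotv_suml (I : Type) (r : seq I) (P : pred I) (F : I -> 'rV[R]_n) u :
  dotv (\sum_(i <- r | P i) F i) u = \sum_(i <- r | P i) dotv (F i) u.
Proof.
by elim/big_rec2: _ => [|i a b _ <-]; rewrite ?dotv0l ?dotvDl.
Qed.

Lemma dotv_sumr (I : Type) (r : seq I) (P : pred I) (F : I -> 'rV[R]_n) u :
  dotv u (\sum_(i <- r | P i) F i) = \sum_(i <- r | P i) dotv u (F i).
Proof. by rewrite dotvC dotv_suml; apply: eq_bigr => i _; rewrite dotvC. Qed.

Lemma dotvv_ge0 u : 0 <= dotv u u.
Proof. by apply: sumr_ge0 => i _; rewrite -expr2 sqr_ge0. Qed.

Lemma dotvv_eq0 u : (dotv u u == 0) = (u == 0).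
Proof.
apply/idP/eqP => [|->]; last by rewrite dotv0l.
rewrite psumr_eq0 => [/allP u0|i _]; last by rewrite -expr2 sqr_ge0.
apply/rowP => i; rewrite mxE; apply/eqP.
by have := u0 i (mem_index_enum i); rewrite -expr2 sqrf_eq0.
Qed.

Lemma dotv_delta u i : dotv u (delta_mx 0 i) = u 0 i.
Proof.
rewrite /dotv (bigD1 i)//= big1 => [|j ji]; rewrite mxE eqxx /=.
  by rewrite eqxx mulr1 addr0.
by rewrite (negbTE ji) mulr0.
Qed.

End Dot.

Section MatrixContinuity.
Context {R : realType}.

Lemma continuous_sum (T : topologicalType) (I : Type) (r : seq I)
    (F : I -> T -> R) :
  (forall i, continuous (F i)) -> continuous (fun t => \sum_(i <- r) F i t).
Proof.
move=> cF t; elim: r => [|i r IH].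
  by under eq_fun do rewrite big_nil; exact: cvg_cst.
by under eq_fun do rewrite big_cons; apply: cvgD => //; exact: cF.
Qed.

Lemma continuous_mx (T : topologicalType) (m k : nat) (f : T -> 'M[R]_(m, k)) :
  (forall i j, continuous (fun t => f t i j)) -> continuous f.
Proof.
move=> cf t; apply/cvgrPdist_le => /= e e0; near=> s.
rewrite /Num.Def.normr/= mx_normrE (bigmax_le _ (ltW e0))//= => i _.
rewrite !mxE/=; move: i; near: s; apply: filter_forall => /= i.
exact: ((cvgrPdist_le _ _).1 (cf i.1 i.2 t)).
Unshelve. all: by end_near. Qed.

Lemma mulmxr_continuous (m k l : nat) (M : 'M[R]_(k, l)) :
  continuous (fun v : 'M[R]_(m, k) => v *m M).
Proof.
apply: continuous_mx => i j; under eq_fun do rewrite mxE.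
apply: continuous_sum => a v; apply: continuousM; first exact: coord_continuous.
exact: cst_continuous.
Qed.

Lemma dotv_continuous (n : nat) (xi : 'rV[R]_n) : continuous (dotv xi).
Proof.
apply: continuous_sum => a v; apply: continuousM; first exact: cst_continuous.
exact: coord_continuous.
Qed.

End MatrixContinuity.

Section Trig.
Context {R : realType}.
Implicit Types t a : R.

Lemma cos_sin_shift_nat t (k : nat) :
  cos (t + 2 * pi * k%:R) = cos t /\ sin (t + 2 * pi * k%:R) = sin t.
Proof.
have -> : 2 * pi * k%:R = pi *+ 2 *+ k :> R by rewrite mulr_natr mulr_natl.
by rewrite (periodicn (@cosD2pi R)) (periodicn (@sinD2pi R)).
Qed.

Lemma cos_sin_shift t a : a \is a Num.int ->
  cos (t + 2 * pi * a) = cos t /\ sin (t + 2 * pi * a) = sin t.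
Proof.
move=> /intrP[[k|k] ->]; first exact: cos_sin_shift_nat.
rewrite NegzE; set s := t + _; have -> : t = s + 2 * pi * k.+1%:R.
  by rewrite /s rmorphN /= -pmulrn; ring.
by have [-> ->] := cos_sin_shift_nat s k.+1.
Qed.

(** The derivative is bounded only up to [|b|], so that [C] may depend on [b]: a constant
    proportional to [|b|] yields the quadratic error bounds used below. *)
Lemma MVT_norm (f df : R -> R) (C b : R) :
  (forall x : R, is_derive x (1 : R) f (df x)) -> 
  (forall x, `|x| <= `|b| -> `|df x| <= C) -> `|f b - f 0| <= C * `|b|.
Proof.
move=> fd dfC.
have cf : continuous f.
  by move=> x; apply: differentiable_continuous; apply/derivable1_diffP; case: (fd x).
have [b0|b0] := leP 0 b.
  have [c cb ->] := MVT_segment b0 (fun x _ => fd x) (continuous_subspaceT cf).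
  rewrite subr0 normrM ler_wpM2r// dfC//.
  by move: cb; rewrite in_itv/= => /andP[c0 cb]; rewrite !ger0_norm.
have [c cb] := MVT_segment (ltW b0) (fun x _ => fd x) (continuous_subspaceT cf).
rewrite sub0r distrC => ->; rewrite normrM normrN ler_wpM2r// dfC//.
move: cb; rewrite in_itv/= => /andP[c0 cb]; rewrite !ler0_norm// ?lerN2// ltW//.
Qed.

Lemma norm_sin_le a : `|sin a| <= `|a|.
Proof.
have := @MVT_norm (@sin R) cos 1 a (fun=> is_derive_sin _) (fun x _ => cos_max x).
by rewrite sin0 subr0 mul1r.
Qed.

Lemma norm_cosB1_le a : `|cos a - 1| <= a ^+ 2.
Proof.
rewrite -cos0 -real_normK ?num_real// expr2.
apply: (@MVT_norm (@cos R) (fun x => - sin x) `|a| a (fun=> is_derive_cos _)) => x xa.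
by rewrite normrN (le_trans (norm_sin_le _)).
Qed.

Lemma norm_sinBid_le (a : R) : `|sin a - a| <= a ^+ 2.
Proof.
have cos1 (x : R) : `|cos x - 1| <= `|x|.
  have := @MVT_norm (@cos R) (fun x => - sin x) 1 x (fun=> is_derive_cos _).
  by rewrite cos0 mul1r; apply => y _; rewrite normrN sin_max.
have fd (x : R) : is_derive x (1 : R) (fun x => sin x - x) (cos x - 1).
  by apply: is_deriveB.
have := @MVT_norm (fun x => sin x - x) (fun x => cos x - 1) `|a| a fd.
rewrite sin0 subrr subr0 -expr2 real_normK ?num_real//; apply => x xa.
exact: le_trans (cos1 x) xa.
Qed.

Lemma dyadic_small (C e : R) : 0 < e -> exists s : nat, C * (2 ^+ s)^-1 < e.
Proof.
move=> e0; pose s := (Num.trunc (C / e)).+1; exists s.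
have Cs : C / e < 2 ^+ s.
  apply: (lt_le_trans (truncnS_gt _)); rewrite -natrX ler_nat.
  exact: ltnW (@ltn_expl 2 s isT).
by rewrite ltr_pdivrMr ?exprn_gt0// mulrC -ltr_pdivrMr.
Qed.

Lemma dyadic_eq0 (X C : R) :
  (forall s : nat, `|X| <= C * (2 ^+ s)^-1) -> X = 0.
Proof.
move=> h; apply/eqP; apply: contraT; rewrite -normr_gt0 => /(dyadic_small C)[s].
by rewrite ltNge h.
Qed.

End Trig.

Section Bounded.
Context {R : realType} {n : nat}.
Implicit Types (phi psi : 'rV[R]_n -> R).

Lemma bdd_cst a : bdd (fun _ : 'rV[R]_n => a).
Proof. by exists `|a|. Qed.

Lemma bddD phi psi : bdd phi -> bdd psi -> bdd (fun u => phi u + psi u).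
Proof.
move=> [C hC] [D hD]; exists (C + D) => u.
by rewrite (le_trans (ler_normD _ _))// lerD.
Qed.

Lemma bddM phi psi : bdd phi -> bdd psi -> bdd (fun u => phi u * psi u).
Proof.
move=> [C hC] [D hD]; exists (C * D) => u.
by rewrite normrM ler_pM.
Qed.

Lemma bddZ a phi : bdd phi -> bdd (fun u => a * phi u).
Proof. by move=> h; apply: bddM => //; exact: bdd_cst. Qed.

Lemma bddN phi : bdd phi -> bdd (fun u => - phi u).
Proof. by move=> [C hC]; exists C => u; rewrite normrN. Qed.

Lemma bddB phi psi : bdd phi -> bdd psi -> bdd (fun u => phi u - psi u).
Proof. by move=> h k; apply: bddD => //; exact: bddN. Qed.

Lemma bdd_sum (I : Type) (r : seq I) (F : I -> 'rV[R]_n -> R) :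
  (forall i, bdd (F i)) -> bdd (fun u => \sum_(i <- r) F i u).
Proof.
move=> bF; elim: r => [|i r IH].
  by under eq_fun do rewrite big_nil; exact: bdd_cst.
by under eq_fun do rewrite big_cons; exact: bddD.
Qed.

Lemma bddX phi k : bdd phi -> bdd (fun u => phi u ^+ k).
Proof.
move=> bphi; elim: k => [|k IH]; first by under eq_fun do rewrite expr0; exact: bdd_cst.
by under eq_fun do rewrite exprS; exact: bddM.
Qed.

Lemma bdd_cos phi : bdd (fun u => cos (phi u)).
Proof. by exists 1 => u; exact: cos_max. Qed.

Lemma bdd_sin phi : bdd (fun u => sin (phi u)).
Proof. by exists 1 => u; exact: sin_max. Qed.

End Bounded.

#[global] Hint Resolve bdd_cst bdd_cos bdd_sin : core.

(** * Fourier coefficients of periodic functions *)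

Section Fourier.
Context {R : realType} {n : nat}.
Variables (B : 'M[R]_n) (J : ('rV[R]_n -> R) -> R).
Hypotheses (Bunit : B \in unitmx) (mJ : is_mean B J).
Implicit Types (phi psi h : 'rV[R]_n -> R) (u v xi eta : 'rV[R]_n).

Definition phase xi u : R := 2 * pi * dotv xi u.

Definition is_dual xi : Prop := forall z, dotv xi (latv B z) \is a Num.int.

Lemma dualD xi eta : is_dual xi -> is_dual eta -> is_dual (xi + eta).
Proof. by move=> h k z; rewrite dotvDl rpredD ?h ?k. Qed.

Lemma dualN xi : is_dual xi -> is_dual (- xi).
Proof. by move=> h z; rewrite dotvNl rpredN. Qed.

Lemma dual0 : is_dual 0.
Proof. by move=> z; rewrite dotv0l rpred0. Qed.

Lemma phaseDl xi eta u : phase (xi + eta) u = phase xi u + phase eta u.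
Proof. by rewrite /phase dotvDl mulrDr. Qed.

Lemma phaseNl xi u : phase (- xi) u = - phase xi u.
Proof. by rewrite /phase dotvNl mulrN. Qed.

Lemma phaseDr xi u v : phase xi (u + v) = phase xi u + phase xi v.
Proof. by rewrite /phase dotvDr mulrDr. Qed.

Lemma phaseZr xi a u : phase xi (a *: u) = a * phase xi u.
Proof. by rewrite /phase dotvZr mulrCA. Qed.

Lemma phase0l u : phase 0 u = 0.
Proof. by rewrite /phase dotv0l mulr0. Qed.

Lemma phase_continuous xi : continuous (phase xi).
Proof.
move=> u; apply: (@continuousM R _ (fun=> 2 * pi) (dotv xi)).
  exact: cst_continuous.
exact: dotv_continuous.
Qed.

Lemma latper_trig xi a : is_dual xi ->
  lattice_per B (fun u => cos (phase xi u + a)) /\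
  lattice_per B (fun u => sin (phase xi u + a)).
Proof.
by move=> dxi; split=> u z; have [ec es] := cos_sin_shift (phase xi u + a) (dxi z);
  rewrite phaseDr addrAC.
Qed.

(** Integer and fractional parts of the coordinates in the basis [B]: the closed unit box, which is
    compact, meets every class modulo the lattice. *)
Lemma lattice_reduce u : exists (v : 'rV[R]_n) (z : 'rV[int]_n),
  (forall i, 0 <= v 0 i <= 1) /\ u = v *m B + latv B z.
Proof.
pose w := u *m invmx B.
exists (\row_i (w 0 i - (Num.floor (w 0 i))%:~R)), (\row_i Num.floor (w 0 i)).
split=> [i|].
  rewrite mxE subr_ge0 lerBlDl floor_le /=.
  by have := ltW (floorD1_gt (w 0 i)); rewrite intrD addrC.
rewrite /latv -mulmxDl -[LHS](mulmxKV Bunit); congr (_ *m _).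
by apply/rowP => i; rewrite !mxE subrK.
Qed.

Lemma unit_box_compact :
  compact [set v : 'rV[R]_n | forall i, v ord0 i \in `[(0 : R), 1]].
Proof.
apply: (@rV_compact _ _ (fun=> `[(0 : R), 1]%classic)) => i.
exact: segment_compact.
Qed.

Lemma latper_bdd h : continuous h -> lattice_per B h -> bdd h.
Proof.
move=> ch ph.
pose A := [set v : 'rV[R]_n | forall i, v ord0 i \in `[(0 : R), 1]].
have A0 : A !=set0 by exists 0 => i /=; rewrite mxE in_itv /= lexx ler01.
have cg : continuous (fun v : 'rV[R]_n => `|h (v *m B)|).
  move=> v; apply: continuous_comp; last exact: norm_continuous.
  by apply: continuous_comp; [exact: mulmxr_continuous|exact: ch].
have [c _ hc] := compact_EVT_max A0 unit_box_compact (continuous_subspaceT cg).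
exists `|h (c *m B)| => u; have [v [z [v01 ->]]] := lattice_reduce u.
rewrite ph; apply: hc; rewrite inE => i /=; rewrite in_itv /=; exact: v01.
Qed.

Lemma meanN phi : bdd phi -> J (fun u => - phi u) = - J phi.
Proof.
move=> bphi; rewrite -mulN1r -(meanZ mJ)//.
by congr J; apply/funext => u; rewrite mulN1r.
Qed.

Lemma meanB phi psi : bdd phi -> bdd psi ->
  J (fun u => phi u - psi u) = J phi - J psi.
Proof. by move=> h k; rewrite (meanD mJ)// ?meanN//; exact: bddN. Qed.

Lemma mean_norm_le phi C : (forall u, `|phi u| <= C) -> `|J phi| <= C.
Proof.
move=> phiC; have bphi : bdd phi by exists C.
have phiC' u : - C <= phi u <= C by rewrite -ler_norml.
rewrite ler_norml -{1}(mean_cst mJ (- C)) -[X in _ && (_ <= X)](mean_cst mJ C).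
by apply/andP; split; apply: (mean_le mJ) => // u; case/andP: (phiC' u).
Qed.

Lemma mean_sum (I : Type) (r : seq I) (F : I -> 'rV[R]_n -> R) :
  (forall i, bdd (F i)) ->
  J (fun u => \sum_(i <- r) F i u) = \sum_(i <- r) J (F i).
Proof.
move=> bF; elim: r => [|i r IH].
  by under eq_fun do rewrite big_nil; rewrite (mean_cst mJ) big_nil.
under eq_fun do rewrite big_cons; rewrite (meanD mJ)//; last exact: bdd_sum.
by rewrite big_cons IH.
Qed.

(* Integration by parts, obtained by moving the increment of h in the
   direction of a lattice vector onto the character. *)
Lemma mean_derive_trig h D (z : 'rV[int]_n) (C : R) xi tau :
  bdd h -> bdd D -> lattice_per B h -> is_dual xi ->
  (forall u t, `|h (u + t *: latv B z) - h u - t * D u| <= C * t ^+ 2) ->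
  J (fun u => D u * cos (phase xi u - tau)) =
  phase xi (latv B z) * J (fun u => h u * sin (phase xi u - tau)).
Proof.
move=> bh bD ph dxi hD; set b := latv B z; set k := phase xi b.
set c := J (fun u => h u * cos (phase xi u - tau)).
set s := J (fun u => h u * sin _); set d := J _.
apply/eqP; rewrite -subr_eq0; apply/eqP.
(* With [t = 2^-r] and [a = k * t], the number [t * (d - k * s)] is a combination of the Taylor
   remainder of [h], of [cos a - 1] and of [sin a - a], all of order [t^2]. Dividing by [t] leaves
   this constant times [t]. *)
apply: (@dyadic_eq0 _ _ (C + k ^+ 2 * `|c| + k ^+ 2 * `|s|)) => r.
set t := (2 ^+ r)^-1; have t0 : 0 < t by rewrite invr_gt0 exprn_gt0.
pose a := k * t.
(* The mean of [phi] is computed twice: by expanding the delayed cosine ([e1]), and by shifting by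
   [t *: b], which restores the phase and moves the increment onto [h] ([e2]). *)
pose phi u := h u * cos (phase xi u + (- a - tau)).
have bphi : bdd phi by exact: bddM.
have pphi : lattice_per B phi.
  by move=> u w; rewrite /phi ph; congr (_ * _); have [->] := latper_trig (- a - tau) dxi.
have bhc : bdd (fun u => h u * cos (phase xi u - tau)) by exact: bddM.
have bhs : bdd (fun u => h u * sin (phase xi u - tau)) by exact: bddM.
have bDc : bdd (fun u => D u * cos (phase xi u - tau)) by exact: bddM.
have e1 : J phi = cos a * c + sin a * s.
  rewrite /c /s -!(meanZ mJ)// -(meanD mJ)//; [|exact: bddZ..].
  congr J; apply/funext => u; rewrite /phi.
  have -> : phase xi u + (- a - tau) = (phase xi u - tau) - a by ring.
  by rewrite cosB; ring.
have e2 : J phi = J (fun u => h (u + t *: b) * cos (phase xi u - tau)).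
  rewrite -(mean_shift mJ r z bphi pphi); congr J; apply/funext => u.
  rewrite /phi phaseDr phaseZr -/b -/k -/t; congr (_ * cos _); rewrite /a; ring.
have bphi' : bdd (fun u => h (u + t *: b) * cos (phase xi u - tau)).
  by apply: bddM => //; case: bh => M hM; exists M.
have est : `|J phi - c - t * d| <= C * t ^+ 2.
  rewrite e2 /c /d -(meanZ mJ)// -!meanB//; [|exact: bddB|exact: bddZ].
  apply: mean_norm_le => u; rewrite mulrA -!mulrBl normrM.
  by rewrite (le_trans _ (hD u t))// ler_piMr// cos_max.
have t1 : `|d - k * s| * t <= (C + k ^+ 2 * `|c| + k ^+ 2 * `|s|) * t * t.
  have -> : `|d - k * s| * t = `|(J phi - c - t * d) - (cos a - 1) * c - (sin a - a) * s|.
    rewrite -{1}(gtr0_norm t0) -normrM -normrN; congr `|_|.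
    by rewrite e1 /a; ring.
  have -> : (C + k ^+ 2 * `|c| + k ^+ 2 * `|s|) * t * t =
      C * t ^+ 2 + a ^+ 2 * `|c| + a ^+ 2 * `|s| by rewrite /a; ring.
  apply: le_trans (ler_normB _ _) _; apply: lerD.
    apply: le_trans (ler_normB _ _) _; apply: lerD => //.
    by rewrite normrM ler_wpM2r// norm_cosB1_le.
  by rewrite normrM ler_wpM2r// norm_sinBid_le.
by rewrite -(ler_pM2r t0).
Qed.

End Fourier.

(** * Uniqueness of Fourier coefficients *)

Section FourierNull.
Context {R : realType} {n : nat}.
Variables (B : 'M[R]_n) (J : ('rV[R]_n -> R) -> R).
Hypotheses (n_gt0 : (0 < n)%N) (Bunit : B \in unitmx) (mJ : is_mean B J).
Implicit Types (phi psi h : 'rV[R]_n -> R) (u v xi eta : 'rV[R]_n).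

Definition fourier_null h : Prop := bdd h /\ forall xi, is_dual B xi ->
  J (fun u => h u * cos (phase xi u)) = 0 /\
  J (fun u => h u * sin (phase xi u)) = 0.

Lemma fourier_null_phase h xi a : fourier_null h -> is_dual B xi ->
  J (fun u => h u * cos (phase xi u + a)) = 0 /\
  J (fun u => h u * sin (phase xi u + a)) = 0.
Proof.
move=> [bh h0] /h0[c0 s0].
have bc : bdd (fun u => h u * cos (phase xi u)) by exact: bddM.
have bs : bdd (fun u => h u * sin (phase xi u)) by exact: bddM.
split.
  rewrite (_ : (fun u => _) = (fun u => cos a * (h u * cos (phase xi u)) -
      sin a * (h u * sin (phase xi u)))); last first.
    by apply/funext => u; rewrite cosD; ring.
  rewrite (meanB mJ) ?(meanZ mJ)//; [|exact: bddZ..].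
  by rewrite c0 s0 !mulr0 subrr.
rewrite (_ : (fun u => _) = (fun u => cos a * (h u * sin (phase xi u)) +
    sin a * (h u * cos (phase xi u)))); last first.
  by apply/funext => u; rewrite sinD; ring.
rewrite (meanD mJ) ?(meanZ mJ)//; [|exact: bddZ..].
by rewrite c0 s0 !mulr0 addr0.
Qed.

(** Product-to-sum formulas: multiplying by a character translates the frequencies by [+- zeta],
    inside the dual lattice. This is what allows multiplication by powers of [peak]. *)
Lemma fourier_null_cos h zeta a : fourier_null h -> is_dual B zeta ->
  fourier_null (fun u => h u * cos (phase zeta u + a)).
Proof.
move=> h0 dz; have bh := h0.1; split; first exact: bddM.
move=> xi dxi.
have [cp sp] := fourier_null_phase a h0 (dualD dxi dz).
have [cm sm] := fourier_null_phase (- a) h0 (dualD dxi (dualN dz)).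
split.
  rewrite (_ : (fun u => _) = (fun u => 2^-1 * (h u * cos (phase (xi + zeta) u + a)) +
      2^-1 * (h u * cos (phase (xi - zeta) u - a)))); last first.
    apply/funext => u; rewrite !phaseDl phaseNl.
    have -> : phase xi u + phase zeta u + a = phase xi u + (phase zeta u + a) by ring.
    have -> : phase xi u - phase zeta u - a = phase xi u - (phase zeta u + a) by ring.
    move: (phase zeta u + a) => A.
    by rewrite cosD cosB; field.
  rewrite (meanD mJ) ?(meanZ mJ) ?cp ?cm ?mulr0 ?addr0//;
    by [exact: bddM|apply: bddZ; exact: bddM].
rewrite (_ : (fun u => _) = (fun u => 2^-1 * (h u * sin (phase (xi + zeta) u + a)) +
    2^-1 * (h u * sin (phase (xi - zeta) u - a)))); last first.
  apply/funext => u; rewrite !phaseDl phaseNl.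
  have -> : phase xi u + phase zeta u + a = phase xi u + (phase zeta u + a) by ring.
  have -> : phase xi u - phase zeta u - a = phase xi u - (phase zeta u + a) by ring.
  move: (phase zeta u + a) => A.
  by rewrite sinD sinB; field.
rewrite (meanD mJ) ?(meanZ mJ) ?sp ?sm ?mulr0 ?addr0//;
  by [exact: bddM|apply: bddZ; exact: bddM].
Qed.

Lemma fourier_nullD h k : fourier_null h -> fourier_null k ->
  fourier_null (fun u => h u + k u).
Proof.
move=> [bh h0] [bk k0]; split=> [|xi dxi]; first exact: bddD.
have [ch sh] := h0 _ dxi; have [ck sk] := k0 _ dxi.
by split; under eq_fun do rewrite mulrDl;
  rewrite (meanD mJ) ?ch ?ck ?sh ?sk ?addr0//; exact: bddM.
Qed.

Lemma fourier_nullZ a h : fourier_null h -> fourier_null (fun u => a * h u).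
Proof.
move=> [bh h0]; split=> [|xi dxi]; first exact: bddZ.
have [ch sh] := h0 _ dxi.
by split; under eq_fun do rewrite -mulrA;
  rewrite (meanZ mJ) ?ch ?sh ?mulr0//; exact: bddM.
Qed.

Lemma fourier_null_sum (I : Type) (r : seq I) (F : I -> 'rV[R]_n -> R) :
  (forall i, fourier_null (F i)) ->
  fourier_null (fun u => \sum_(i <- r) F i u).
Proof.
move=> F0; elim: r => [|i r IH].
  under eq_fun do rewrite big_nil; split=> // xi _.
  by split; under eq_fun do rewrite mul0r; rewrite (mean_cst mJ).
by under eq_fun do rewrite big_cons; exact: fourier_nullD.
Qed.

(** The basis of [R^n] dual to the rows of [B]. *)
Definition dual_vec (i : 'I_n) : 'rV[R]_n := row i (invmx B)^T.

Lemma dotv_dual_vec i u : dotv (dual_vec i) u = (u *m invmx B) 0 i.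
Proof. by rewrite mxE; apply: eq_bigr => j _; rewrite !mxE mulrC. Qed.

Lemma dual_dual_vec i : is_dual B (dual_vec i).
Proof.
by move=> z; rewrite dotv_dual_vec /latv mulmxK// mxE intr_int.
Qed.

(* The powers of peak u0 concentrate at the lattice translates of u0. *)
Definition peak (u0 u : 'rV[R]_n) : R := n%:R^-1 *
  \sum_(i < n) (1 + cos (phase (dual_vec i) u - phase (dual_vec i) u0)) / 2.

Lemma bdd_peak u0 : bdd (peak u0).
Proof.
by apply: bddZ; apply: bdd_sum => i; apply: bddM => //; exact: bddD.
Qed.

Lemma peak_ge0 u0 u : 0 <= peak u0 u.
Proof.
rewrite mulr_ge0 ?invr_ge0//; apply: sumr_ge0 => i _.
by rewrite divr_ge0// addrC -lerBlDr sub0r cos_geN1.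
Qed.

Lemma fourier_null_peak h u0 k :
  fourier_null h -> fourier_null (fun u => h u * peak u0 u ^+ k).
Proof.
move=> h0; elim: k => [|k IH]; first by under eq_fun do rewrite expr0 mulr1.
set g := (fun u => h u * _) in IH.
rewrite (_ : (fun u => _) = (fun u => n%:R^-1 * \sum_(i < n) (2^-1 * g u +
   2^-1 * (g u * cos (phase (dual_vec i) u - phase (dual_vec i) u0))))); last first.
  apply/funext => u; rewrite exprSr mulrA /peak mulrCA; congr (_ * _).
  rewrite mulr_sumr; apply: eq_bigr => i _; rewrite -/(g u); by field.
apply: fourier_nullZ; apply: fourier_null_sum => i; apply: fourier_nullD.
  exact: fourier_nullZ.
by apply: fourier_nullZ; apply: fourier_null_cos => //; exact: dual_dual_vec.
Qed.

(** The integer nearest to [w] is at distance at most [1/2], so the angle [2 pi |w - l|] lies in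
    [[0, pi]], where cosine decreases. *)
Lemma near_int_of_cos (delta : R) : 0 < delta -> delta < 2^-1 -> forall w,
  cos (2 * pi * delta) < cos (2 * pi * w) ->
  exists l : int, `|w - l%:~R| < delta.
Proof.
move=> d0 d1 w lt_cos; exists (Num.floor (w + 2^-1)); rewrite ltNge; apply/negP => le_d.
set l := Num.floor _ in le_d.
have wl : `|w - l%:~R| <= 2^-1.
  have := floor_le (w + 2^-1); have := ltW (floorD1_gt (w + 2^-1)).
  by rewrite -/l intrD ler_norml => h1 h2; apply/andP; split; lra.
have e : cos (2 * pi * w) = cos (2 * pi * `|w - l%:~R|).
  have -> : 2 * pi * `|w - l%:~R| = `|2 * pi * (w - l%:~R)|.
    by rewrite normrM ger0_norm// mulr_ge0// pi_ge0.
  rewrite cos_norm mulrBr -mulrN -rmorphN /=.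
  by have [->] := cos_sin_shift (2 * pi * w) (intr_int R (- l)).
have p0 := @pi_gt0 R.
suff : cos (2 * pi * w) <= cos (2 * pi * delta) by rewrite leNgt lt_cos.
have h x : 0 <= x <= 2^-1 -> 2 * pi * x \in `[0, pi].
  move=> /andP[x0 x1]; rewrite in_itv /= !mulr_ge0 ?pi_ge0//= mulrAC.
  by rewrite ler_piMl ?pi_ge0//; lra.
rewrite e leNgt ltr_cos ?h ?normr_ge0 ?wl ?(ltW d0) ?(ltW d1)//.
by rewrite -leNgt ler_pM2l// mulr_gt0.
Qed.

(** A value of [peak] near 1 forces every cosine in it near 1, hence all coordinates of [u - u0]
    near integers; [u] is then close to [u0] modulo the lattice, and continuity of [h] at [u0]
    applies. *)
Lemma near_of_peak h u0 : continuous h -> lattice_per B h -> 0 < h u0 ->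
  exists2 q : R, 0 <= q < 1 & forall u, q < peak u0 u -> h u0 / 2 <= h u.
Proof.
move=> ch ph h0; set z0 := u0 *m invmx B.
have [d d0 hd] : exists2 d : R, 0 < d & forall v : 'rV[R]_n,
    (forall i, `|z0 0 i - v 0 i| < d) -> h u0 / 2 <= h (v *m B).
  have cg : continuous (fun v : 'rV[R]_n => h (v *m B)).
    by move=> v; apply: continuous_comp; [exact: mulmxr_continuous|exact: ch].
  have h20 : 0 < h u0 / 2 by rewrite divr_gt0.
  have /cvgrPdist_le /(_ _ h20) := cg z0.
  move=> /nbhs_ballP[d /= d0 hd]; exists d => // v vd.
  have /hd : ball z0 d v.
    by split => // i j; rewrite (ord1 i); exact: vd.
  by rewrite /= /z0 mulmxKV// ler_distl => /andP[_]; lra.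
(* The bound [1/4] keeps [d'] below [1/2], as [near_int_of_cos] requires. *)
pose d' := Num.min d 4^-1.
have d'0 : 0 < d' by rewrite lt_min d0 invr_gt0 ltr0n.
have d'1 : d' < 2^-1 by rewrite gt_min; apply/orP; right; lra.
set kap := cos (2 * pi * d').
have kap1 : kap < 1.
  have p0 := @pi_gt0 R.
  rewrite -(@cos0 R) ltr_cos ?in_itv /= ?lexx ?pi_ge0 ?mulr_gt0//.
  rewrite !mulr_ge0 ?pi_ge0 ?(ltW d'0)//= mulrAC ler_piMl ?pi_ge0//; lra.
have kap2 : -1 <= kap by exact: cos_geN1.
have n0 : 0 < n%:R :> R by rewrite ltr0n.
have n1 : n%:R^-1 <= 1 :> R by rewrite invf_le1// ler1n.
(* The largest value of [peak] when one of its cosines is at most [kap] and the others are at most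
   1. *)
exists (1 - n%:R^-1 * ((1 - kap) / 2)).
  apply/andP; split.
    rewrite subr_ge0 -[leRHS]mulr1; apply: ler_pM => //; try lra.
  by rewrite gtrBl mulr_gt0 ?invr_gt0//; lra.
move=> u qu.
have kc i : kap < cos (2 * pi * ((u *m invmx B) 0 i - z0 0 i)).
  rewrite ltNge; apply/negP => le_k; move: qu; rewrite ltNge => /negP; apply.
  rewrite /peak -[X in X - n%:R^-1 * _](mulVf (lt0r_neq0 n0)) -mulrBr.
  rewrite ler_wpM2l ?invr_ge0 ?ler0n//.
  rewrite (bigD1 i)//= /phase !dotv_dual_vec -mulrBr.
  rewrite (_ : n%:R - _ = (1 + kap) / 2 + (n%:R - 1)); last by lra.
  apply: lerD; first by lra.
  apply: (@le_trans _ _ (\sum_(j < n | j != i) 1)).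
    apply: ler_sum => j _.
    have := cos_le1 (2 * pi * dotv (dual_vec j) u - 2 * pi * dotv (dual_vec j) u0).
    by lra.
  by rewrite sumr_const cardC1 card_ord -subn1 natrB.
have [l hl] : exists l : 'I_n -> int, forall i,
    `|(u *m invmx B) 0 i - z0 0 i - (l i)%:~R| < d'.
  have ex i : exists l : int, `|(u *m invmx B) 0 i - z0 0 i - l%:~R| < d'.
    exact: near_int_of_cos d'0 d'1 _ (kc i).
  by exists (fun i => sval (cid (ex i))) => i; exact: svalP (cid (ex i)).
have -> : u = (u *m invmx B - map_mx (fun k : int => k%:~R) (\row_i l i)) *m B
    + latv B (\row_i l i).
  by rewrite mulmxBl mulmxKV// subrK.
rewrite ph; apply: hd => i; have := hl i.
move: (u *m invmx B) {hl kc} => w; clearbody z0; rewrite lt_min => /andP[+ _].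
by move=> h1; rewrite !mxE distrC addrAC.
Qed.

End FourierNull.

Section PeakArgument.
Context {R : realType} {n : nat}.
Variables (B : 'M[R]_n) (J : ('rV[R]_n -> R) -> R).
Hypotheses (n_gt0 : (0 < n)%N) (Bunit : B \in unitmx) (mJ : is_mean B J).
Implicit Types (phi psi h : 'rV[R]_n -> R) (u v xi eta : 'rV[R]_n).

(** Some translate of [u] by the grid of mesh [2^-s] has all its coordinates within [2^-s] of those
    of [u0], modulo integers; there the quadratic bound on [1 - cos] makes [peak] at least [r] once
    [(2 pi)^2 2^-s < 1 - r]. *)
Lemma peak_cover u0 (r : R) : r < 1 -> exists s : nat, forall u,
  exists t : 'rV['I_(2 ^ s)]_n,
  r <= peak B u0 (u + (2 ^+ s)^-1 *: latv B (map_mx (fun k : 'I_(2 ^ s) => (k : nat)%:Z) t)).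
Proof.
move=> r1; have r0 : 0 < 1 - r by rewrite subr_gt0.
have [s hs] := dyadic_small ((2 * pi) ^+ 2) r0; exists s => u.
set L : R := 2 ^+ s.
have L0 : 0 < L by rewrite exprn_gt0.
have L1 : 1 <= L by rewrite exprn_ege1// ler1n.
pose w i := dotv (dual_vec B i) u0 - dotv (dual_vec B i) u.
(* The number of grid steps from [u] towards [u0] in direction [i]. Reducing it modulo [2 ^ s]
   changes the translate by a lattice vector only, and [f] measures the error left, in grid
   steps. *)
pose m i := Num.floor (L * w i).
have s0 : (2 ^ s)%N%:Z != 0 by rewrite eqz_nat expn_eq0.
have tlt i : (`|(m i %% (2 ^ s)%N)%Z| < 2 ^ s)%N.
  by rewrite -ltz_nat gez0_abs ?modz_ge0// ltz_pmod// ltz_nat expn_gt0.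
exists (\row_i Ordinal (tlt i)); rewrite /peak.
have n0 : 0 < n%:R :> R by rewrite ltr0n.
rewrite -[r](mulKf (lt0r_neq0 n0)) ler_wpM2l ?invr_ge0 ?ler0n//.
rewrite mulr_natl -[X in r *+ X]card_ord -sumr_const; apply: ler_sum => i _.
set f := L * w i - (m i)%:~R.
have f01 : 0 <= f <= 1.
  rewrite /f subr_ge0 lerBlDl /m floor_le /=.
  by have := ltW (floorD1_gt (L * w i)); rewrite intrD addrC.
have -> : cos (phase (dual_vec B i) (u + L^-1 *: latv B (map_mx
     (fun k : 'I_(2 ^ s) => (k : nat)%:Z) (\row_i0 Ordinal (tlt i0)))) -
     phase (dual_vec B i) u0) = cos (2 * pi * (f / L)).
  rewrite -cosN -[RHS](proj1 (cos_sin_shift _ (intr_int R (m i %/ (2 ^ s)%N)%Z))).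
  congr cos; rewrite /phase dotvDr dotvZr [dotv _ (latv _ _)]dotv_dual_vec.
  rewrite /latv mulmxK// !mxE /=.
  have mE : (m i)%:~R = ((m i %/ (2 ^ s)%N)%Z)%:~R * L +
       (Posz `|(m i %% (2 ^ s)%N)%Z|%N)%:~R :> R.
    rewrite {1}(divz_eq (m i) (2 ^ s)%N) rmorphD rmorphM /= gez0_abs ?modz_ge0//.
    by rewrite -(pmulrn 1 (2 ^ s)) natrX.
  have wE : dotv (dual_vec B i) u0 = dotv (dual_vec B i) u + w i by rewrite /w; ring.
  rewrite /f mE wE; field; exact: lt0r_neq0.
have c1 := norm_cosB1_le (2 * pi * (f / L)).
(* As [0 <= f <= 1 <= L], one has [(f / L)^2 <= 1 / L], which matches the choice of [s]. *)
have c2 : (2 * pi * (f / L)) ^+ 2 <= (2 * pi) ^+ 2 / L.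
  rewrite exprMn ler_wpM2l ?sqr_ge0// expr_div_n ler_pdivrMr ?exprn_gt0//.
  rewrite expr2 [L ^+ 2]expr2 mulrA mulVf ?lt0r_neq0// mul1r.
  case/andP: f01 => f0 f1; apply: le_trans L1; exact: mulr_ile1.
by move: c1; rewrite ler_norml => /andP[c1 _]; move: hs c1 c2; rewrite -/L; lra.
Qed.

(** Finitely many dyadic translates of the superlevel set cover the space and all have the same
    mean, so 1 is at most a multiple of that mean. The indicator is discontinuous, hence a mean on
    all bounded functions. *)
Lemma mean_peak_gt0 u0 (r : R) : r < 1 ->
  0 < J (fun u => if r <= peak B u0 u then 1 else 0).
Proof.
move=> r1; have [s cover] := peak_cover u0 r1.
set chi := fun u : 'rV[R]_n => if r <= peak B u0 u then 1 : R else 0.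
have bchi : bdd chi.
  by exists 1 => u; rewrite /chi; case: ifP => _; rewrite ?normr1 ?normr0.
have pchi : lattice_per B chi.
  move=> u z; rewrite /chi; suff -> : peak B u0 (u + latv B z) = peak B u0 u by [].
  rewrite /peak; congr (_ * _); apply: eq_bigr => i _.
  by have [->] := latper_trig (- phase (dual_vec B i) u0) (dual_dual_vec Bunit i).
pose sh (t : 'rV['I_(2 ^ s)]_n) : 'rV[R]_n := 
  (2 ^+ s)^-1 *: latv B (map_mx (fun k : 'I_(2 ^ s) => (k : nat)%:Z) t).
have bt t : bdd (fun u => chi (u + sh t)) by case: bchi => C hC; exists C.
have : 1 <= J (fun u => \sum_t chi (u + sh t)).
  rewrite -(mean_cst mJ 1); apply: (mean_le mJ) => //; first exact: bdd_sum.
  move=> u; have [t ht] := cover u; rewrite (bigD1 t)//= {1}/chi ht lerDl.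
  by apply: sumr_ge0 => t' _; rewrite /chi; case: ifP.
rewrite (mean_sum mJ)// (eq_bigr (fun=> J chi)) => [|t _]; last exact: (mean_shift mJ).
rewrite sumr_const => h1; rewrite ltNge; apply/negP => h2.
have : J chi *+ #|{: 'rV['I_(2 ^ s)]_n}| <= 0 by rewrite mulrn_wle0.
by rewrite leNgt (lt_le_trans ltr01 h1).
Qed.

(** If [h u0 > 0], then with [q] from [near_of_peak] and [q < r < 1], the product [h * peak^k] is at
    least [(h u0 / 2) r^k] where [peak >= r], nonnegative where [peak > q], and at least [- C q^k]
    elsewhere. Its mean is 0, so [(h u0 / 2) * J chi <= C (q / r)^k], which tends to 0. *)
Lemma fourier_null_le0 h u0 : continuous h -> lattice_per B h ->
  fourier_null B J h -> h u0 <= 0.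
Proof.
move=> ch ph h0; rewrite leNgt; apply/negP => hu0.
have [q /andP[q0 q1] hq] := near_of_peak n_gt0 Bunit ch ph hu0.
pose r := (1 + q) / 2; have r1 : r < 1 by rewrite /r; lra.
have qr : q < r by rewrite /r; lra.
have r0 : 0 < r by exact: le_lt_trans qr.
set chi := fun u : 'rV[R]_n => if r <= peak B u0 u then 1 : R else 0.
have chi0 : 0 < J chi := mean_peak_gt0 u0 r1.
have bchi : bdd chi.
  by exists 1 => u; rewrite /chi; case: ifP => _; rewrite ?normr1 ?normr0.
have [C hC] := h0.1.
have C0 : 0 <= C by exact: le_trans (hC 0).
have key k : h u0 / 2 * J chi <= C * (q / r) ^+ k.
  have : J (fun u => (h u0 / 2 * r ^+ k) * chi u - C * q ^+ k) <=
      J (fun u => h u * peak B u0 u ^+ k).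
    apply: (mean_le mJ); first by apply: bddB => //; exact: bddZ.
      by apply: bddM; [exact: h0.1|apply: bddX; exact: bdd_peak].
    move=> u; have Q0 := peak_ge0 B u0 u.
    have [qQ|Qq] := ltP q (peak B u0 u).
      have hu := hq _ qQ; apply: (@le_trans _ _ (h u0 / 2 * peak B u0 u ^+ k)).
        apply: (@le_trans _ _ (h u0 / 2 * r ^+ k * chi u)).
          by rewrite gerBl mulr_ge0// exprn_ge0.
        rewrite -mulrA ler_wpM2l ?divr_ge0 ?(ltW hu0)// /chi; case: ifP => [rQ|_].
          by rewrite mulr1 lerXn2r// nnegrE ltW.
        by rewrite mulr0 exprn_ge0.
      by rewrite ler_wpM2r// exprn_ge0.
    rewrite /chi [r <= _]leNgt (le_lt_trans Qq qr) /= mulr0 sub0r.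
    apply: (@le_trans _ _ (- `|h u * peak B u0 u ^+ k|)); last exact: lerNnormlW.
    rewrite lerN2 normrM; apply: ler_pM => //.
    by rewrite ger0_norm ?exprn_ge0// lerXn2r// nnegrE.
  (* The coefficient at frequency 0 is the plain mean of the product. *)
  have [_ /(_ 0 (dual0 _))[+ _]] := fourier_null_peak Bunit mJ u0 k h0.
  under eq_fun do rewrite phase0l cos0 mulr1; move=> ->.
  rewrite (meanB mJ)// ?(meanZ mJ)// ?(mean_cst mJ); last exact: bddZ.
  rewrite subr_le0 => h1; rewrite expr_div_n [leRHS]mulrA.
  by rewrite ler_pdivlMr ?exprn_gt0// mulrAC.
have qr_ge0 : 0 <= q / r by exact: divr_ge0 q0 (ltW r0).
have qr1 : `|q / r| < 1 by rewrite ger0_norm// ltr_pdivrMr ?mul1r.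
have : (fun k => C * (q / r) ^+ k) @ \oo --> C * 0.
  by apply: cvgMl_tmp; exact: cvg_expr.
rewrite mulr0 => cv.
have : h u0 / 2 * J chi <= 0.
  rewrite -(cvg_lim _ cv)//; apply: limr_ge; first by apply/cvg_ex; exists 0.
  by apply: nearW => k; exact: key.
by rewrite leNgt mulr_gt0// divr_gt0.
Qed.

Lemma fourier_uniqueness h : continuous h -> lattice_per B h ->
  fourier_null B J h -> forall u, h u = 0.
Proof.
move=> ch ph h0 u; apply/le_anti/andP; split; first exact: fourier_null_le0.
have h1 : fourier_null B J (fun u => -1 * h u) by exact: fourier_nullZ.
have := @fourier_null_le0 (fun u => -1 * h u) u.
rewrite mulN1r oppr_le0; apply => //.
  move=> v; apply: (@continuousM R _ (fun=> -1) h); last exact: ch.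
  exact: cst_continuous.
by move=> v z; rewrite ph.
Qed.

End PeakArgument.

(** * Derivatives of smooth periodic maps *)

Section SmoothPeriodic.
Context {R : realType} {n p : nat}.
Implicit Types (y f g : 'rV[R]_n -> 'rV[R]_p) (u v w : 'rV[R]_n).

Lemma smooth_derive y v : smooth y -> smooth (fun u => 'D_v y u).
Proof. by move=> sy k; have [_] := sy k.+1; apply. Qed.

Lemma smooth_differentiable y u : smooth y -> differentiable y u.
Proof. by move=> sy; have [+ _] := sy 1%N; apply. Qed.

Lemma smooth_coord_continuous y a : smooth y -> continuous (fun u => y u 0 a).
Proof.
move=> sy u; apply: (@continuous_comp _ _ _ y (fun M : 'rV[R]_p => M 0 a)).
  exact: (sy 0%N u).
exact: coord_continuous.
Qed.

Lemma smooth_cst (c : 'rV[R]_p) : smooth (fun _ : 'rV[R]_n => c).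
Proof.
move=> k; elim: k c => [|k IH] c /=; first exact: cst_continuous.
split=> [u|v]; first exact: differentiable_cst.
by under eq_fun do rewrite derive_cst; exact: IH.
Qed.

Lemma latper_derive (B : 'M[R]_n) y v :
  lattice_per B y -> lattice_per B (fun u => 'D_v y u).
Proof.
move=> py u z.
have e : (fun h : R => h^-1 *: ((y \o shift (u + latv B z)) (h *: v) - y (u + latv B z)))
    = (fun h : R => h^-1 *: ((y \o shift u) (h *: v) - y u)).
  by apply/funext => h /=; rewrite addrA !py.
by rewrite /derive e.
Qed.

Lemma smooth_derivable_coord y u v a : smooth y ->
  derivable (fun u => y u 0 a) u v.
Proof.
move=> sy; have /derivable_mxP : derivable y u v.
  by apply: diff_derivable; exact: smooth_differentiable.
exact.
Qed.

Lemma smooth_derive_coord y u v a : smooth y ->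
  'D_v y u 0 a = 'D_v (fun u => y u 0 a) u.
Proof.
move=> sy; rewrite derive_mx ?mxE//.
by apply: diff_derivable; exact: smooth_differentiable.
Qed.

Lemma smooth_line y u v a (t : R) : smooth y ->
  is_derive t (1 : R) (fun t => y (u + t *: v) 0 a) ('D_v y (u + t *: v) 0 a).
Proof.
move=> sy; have dy := @smooth_derivable_coord y (u + t *: v) v a sy.
have e : (fun h : R => h^-1 *: (y (u + (h *: (1 : R) + t) *: v) 0 a - y (u + t *: v) 0 a)) =
    (fun h : R => h^-1 *: (y (h *: v + (u + t *: v)) 0 a - y (u + t *: v) 0 a)).
  apply/funext => h; congr (_ *: (y _ _ _ - _)).
  by rewrite scalerDl [h *: 1]mulr1 addrCA.
split; first by rewrite /derivable /= e.
by rewrite smooth_derive_coord// /derive /= e.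
Qed.

Lemma derive_lin_comb y u (I : Type) (r : seq I) (c : I -> R) (F : I -> 'rV[R]_n) :
  smooth y ->
  'D_(\sum_(i <- r) c i *: F i) y u = \sum_(i <- r) c i *: 'D_(F i) y u.
Proof.
move=> sy; have dy := @smooth_differentiable y u sy.
rewrite deriveE// linear_sum; apply: eq_bigr => i _.
by rewrite linearZ deriveE.
Qed.

Lemma derive_dotv f g u v : smooth f -> smooth g ->
  'D_v (fun u => dotv (f u) (g u)) u =
  dotv ('D_v f u) (g u) + dotv (f u) ('D_v g u).
Proof.
move=> sf sg; rewrite /dotv.
rewrite (_ : (fun u => _) = \sum_(i < p) (fun u => f u 0 i * g u 0 i)); last first.
  by apply/funext => w; rewrite fct_sumE.
rewrite derive_sum => [|i]; last first.
  by apply: derivableM; exact: smooth_derivable_coord.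
rewrite -big_split; apply: eq_bigr => i _ /=.
rewrite (@deriveM _ _ (fun u => f u 0 i) (fun u => g u 0 i));
  [|exact: smooth_derivable_coord..].
by rewrite !smooth_derive_coord// addrC; congr (_ + _); exact: mulrC.
Qed.

End SmoothPeriodic.

Section FourierDerive.
Context {R : realType} {n p : nat}.
Variables (B : 'M[R]_n) (J : ('rV[R]_n -> R) -> R).
Hypotheses (n_gt0 : (0 < n)%N) (Bunit : B \in unitmx) (mJ : is_mean B J).
Implicit Types (y : 'rV[R]_n -> 'rV[R]_p) (u v w xi : 'rV[R]_n).

Lemma smooth_bdd y a : smooth y -> lattice_per B y -> bdd (fun u => y u 0 a).
Proof.
move=> sy py; apply: (latper_bdd Bunit); first exact: smooth_coord_continuous.
by move=> u z; rewrite py.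
Qed.

(** The second derivative along [v] is continuous and periodic, hence bounded, so a single [C]
    serves all base points; the mean value inequality is applied twice. *)
Lemma smooth_taylor y v a : smooth y -> lattice_per B y -> exists C, forall u t,
  `|y (u + t *: v) 0 a - y u 0 a - t * 'D_v y u 0 a| <= C * t ^+ 2.
Proof.
move=> sy py; have sy' := smooth_derive v sy; have sy'' := smooth_derive v sy'.
have [C hC] := smooth_bdd a sy'' (latper_derive v (latper_derive v py)).
exists C => u t.
have d1 s : `|'D_v y (u + s *: v) 0 a - 'D_v y u 0 a| <= C * `|s|.
  have := @MVT_norm R _ _ C s
    (fun s => @smooth_line R n p (fun u => 'D_v y u) u v a s sy')
    (fun s _ => hC (u + s *: v)).
  by rewrite scale0r addr0.
have fd s : is_derive s (1 : R) (fun s => y (u + s *: v) 0 a - s * 'D_v y u 0 a)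
    ('D_v y (u + s *: v) 0 a - 'D_v y u 0 a).
  have h1 := @smooth_line R n p y u v a s sy.
  have h2 : is_derive s (1 : R) (fun s : R => s * 'D_v y u 0 a) ('D_v y u 0 a).
    have hM := @is_deriveM R R (fun s => s) (fun=> 'D_v y u 0 a) s 1 1 0 _ _.
    by apply: is_derive_eq; rewrite scaler0 add0r [LHS]mulr1.
  by apply: is_deriveB.
have := @MVT_norm R _ _ (C * `|t|) t fd.
rewrite scale0r addr0 mul0r subr0 -mulrA -expr2 real_normK ?num_real// addrAC.
apply => s st; apply: le_trans (d1 s) _; rewrite ler_wpM2l//.
exact: le_trans (hC 0).
Qed.

(** [mean_derive_trig] covers lattice directions, along which [J] has its invariance; a general [v]
    is a real combination of basis vectors and both sides are linear in [v]. The phase offset [tau]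
    treats both formulas at once: 0 gives the cosine and [pi / 2] the sine. *)
Lemma fourier_derive y v a xi : smooth y -> lattice_per B y -> is_dual B xi ->
  J (fun u => 'D_v y u 0 a * cos (phase xi u)) =
    phase xi v * J (fun u => y u 0 a * sin (phase xi u)) /\
  J (fun u => 'D_v y u 0 a * sin (phase xi u)) =
    - (phase xi v * J (fun u => y u 0 a * cos (phase xi u))).
Proof.
move=> sy py dxi.
have bD w : bdd (fun u => 'D_w y u 0 a).
  by apply: smooth_bdd; [exact: smooth_derive|exact: latper_derive].
have lat z tau : J (fun u => 'D_(latv B z) y u 0 a * cos (phase xi u - tau)) =
    phase xi (latv B z) * J (fun u => y u 0 a * sin (phase xi u - tau)).
  have [C hC] := smooth_taylor (latv B z) a sy py.
  apply: (mean_derive_trig mJ tau _ (bD _) _ dxi hC) => //.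
    exact: smooth_bdd.
  by move=> u w; rewrite py.
have gen tau : J (fun u => 'D_v y u 0 a * cos (phase xi u - tau)) =
    phase xi v * J (fun u => y u 0 a * sin (phase xi u - tau)).
  pose c i := (v *m invmx B) 0 i.
  have vE : v = \sum_i c i *: latv B (delta_mx 0 i).
    rewrite -[LHS](mulmxKV Bunit) mulmx_sum_row; apply: eq_bigr => i _.
    rewrite /latv; congr (_ *: _); rewrite rowE; congr (_ *m _).
    by apply/rowP => j; rewrite !mxE; case: (_ && _).
  rewrite {1}(_ : (fun u => _) = (fun u => \sum_i c i *
     ('D_(latv B (delta_mx 0 i)) y u 0 a * cos (phase xi u - tau)))); last first.
    apply/funext => u; rewrite {1}vE derive_lin_comb// summxE mulr_suml.
    by apply: eq_bigr => i _; rewrite mxE mulrA.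
  have bt i : bdd (fun u => 'D_(latv B (delta_mx 0 i)) y u 0 a * cos (phase xi u - tau)).
    exact: bddM.
  rewrite (mean_sum mJ) => [|i]; last exact: bddZ.
  rewrite [in RHS]vE /phase dotv_sumr mulr_sumr mulr_suml; apply: eq_bigr => i _.
  by rewrite (meanZ mJ)// lat dotvZr /phase !mulrA; congr (_ * _); ring.
split.
  by have := gen 0; under eq_fun do rewrite subr0; under [in RHS]eq_fun do rewrite subr0.
have := gen (pi / 2); under eq_fun do rewrite cosBpihalf.
under [in RHS]eq_fun do rewrite sinBpihalf mulrN.
by rewrite (meanN mJ) ?mulrN//; apply: bddM => //; exact: smooth_bdd.
Qed.

Lemma smooth_fourier_inj (f g : 'rV[R]_n -> 'rV[R]_p) :
  smooth f -> smooth g -> lattice_per B f -> lattice_per B g ->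
  (forall a xi, is_dual B xi ->
    J (fun u => f u 0 a * cos (phase xi u)) = J (fun u => g u 0 a * cos (phase xi u)) /\
    J (fun u => f u 0 a * sin (phase xi u)) = J (fun u => g u 0 a * sin (phase xi u))) ->
  forall u, f u = g u.
Proof.
move=> sf sg pf pg fg u; apply/rowP => a.
have bf := smooth_bdd a sf pf; have bg := smooth_bdd a sg pg.
apply/eqP; rewrite -subr_eq0; apply/eqP; move: u.
apply: (fourier_uniqueness n_gt0 Bunit mJ).
- by move=> u; apply: continuousB; exact: smooth_coord_continuous.
- by move=> u z; rewrite pf pg.
split=> [|xi dxi]; first exact: bddB.
have [ec es] := fg a xi dxi.
by split; under eq_fun do rewrite mulrBl;
  rewrite (meanB mJ) ?ec ?es ?subrr//; exact: bddM.
Qed.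

(* Both sides have the same Fourier coefficients. *)
Lemma derive_comm y v w u : smooth y -> lattice_per B y ->
  'D_v (fun u => 'D_w y u) u = 'D_w (fun u => 'D_v y u) u.
Proof.
move=> sy py.
have sv := smooth_derive v sy; have sw := smooth_derive w sy.
have pv := latper_derive v py; have pw := latper_derive w py.
have svw := smooth_derive v sw; have swv := smooth_derive w sv.
have pvw := latper_derive v pw; have pwv := latper_derive w pv.
apply: (smooth_fourier_inj svw swv pvw pwv) => a xi dxi.
have [cv sv'] := fourier_derive v a sw pw dxi.
have [cw sw'] := fourier_derive w a sv pv dxi.
have [cv1 sv1] := fourier_derive v a sy py dxi.
have [cw1 sw1] := fourier_derive w a sy py dxi.
split.
  apply: (etrans cv); apply: etrans (esym cw).
  apply: (etrans (congr1 ( *%R (phase xi v)) sw1)).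
  by apply: etrans (esym (congr1 ( *%R (phase xi w)) sv1)); rewrite !mulrN mulrCA.
apply: (etrans sv'); apply: etrans (esym sw').
apply: (etrans (congr1 (fun t => - (phase xi v * t)) cw1)).
by apply: etrans (esym (congr1 (fun t => - (phase xi w * t)) cv1)); rewrite mulrCA.
Qed.

End FourierDerive.

(** * Orthogonality relations of the characters *)

Section Orthogonality.
Context {R : realType} {n : nat}.
Variables (B : 'M[R]_n) (J : ('rV[R]_n -> R) -> R).
Hypotheses (Bunit : B \in unitmx) (mJ : is_mean B J).
Implicit Types (u v w xi zeta eta : 'rV[R]_n).

(** For [zeta != 0], integrate by parts the constant function 1 in the direction [zeta]: its
    derivative is 0 while the factor [phase zeta zeta] is not. *)
Lemma mean_trig zeta : is_dual B zeta ->
  J (fun u => cos (phase zeta u)) = (zeta == 0)%:R /\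
  J (fun u => sin (phase zeta u)) = 0.
Proof.
move=> dz; have [->|z0] := eqVneq zeta 0.
  split; first by under eq_fun do rewrite phase0l cos0; rewrite (mean_cst mJ).
  by under eq_fun do rewrite phase0l sin0; rewrite (mean_cst mJ).
have pz : phase zeta zeta != 0.
  by rewrite /phase !mulf_neq0// ?pnatr_eq0// ?dotvv_eq0// lt0r_neq0// pi_gt0.
have [] := @fourier_derive R n 1 B J Bunit mJ (fun=> 1) zeta 0 zeta (@smooth_cst R n 1 1) _ dz.
  by [].
under eq_fun do rewrite derive_cst mxE mul0r.
under [in X in _ = X -> _]eq_fun do rewrite mxE eqxx mul1r.
rewrite (mean_cst mJ) => /esym/eqP; rewrite mulf_eq0 (negbTE pz) => /eqP ->.
under eq_fun do rewrite derive_cst mxE mul0r.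
under [in X in _ = X -> _]eq_fun do rewrite mxE eqxx mul1r.
rewrite (mean_cst mJ) => /esym/eqP; rewrite oppr_eq0 mulf_eq0 (negbTE pz).
by move=> /eqP ->.
Qed.

Lemma mean_trig_mul zeta eta : is_dual B zeta -> is_dual B eta ->
  [/\ J (fun u => cos (phase zeta u) * cos (phase eta u)) =
        2^-1 * ((zeta == eta)%:R + (zeta == - eta)%:R),
      J (fun u => sin (phase zeta u) * sin (phase eta u)) =
        2^-1 * ((zeta == eta)%:R - (zeta == - eta)%:R),
      J (fun u => cos (phase zeta u) * sin (phase eta u)) = 0 &
      J (fun u => sin (phase zeta u) * cos (phase eta u)) = 0].
Proof.
move=> dz de.
have [cp sp] := mean_trig (dualD dz de).
have [cm sm] := mean_trig (dualD dz (dualN de)).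
rewrite -subr_eq0 -(addr_eq0 zeta eta).
split.
- rewrite (_ : (fun u => _) = (fun u => 2^-1 * cos (phase (zeta - eta) u) +
      2^-1 * cos (phase (zeta + eta) u))); last first.
    by apply/funext => u; rewrite !phaseDl phaseNl cosB cosD; field.
  by rewrite (meanD mJ) ?(meanZ mJ)// ?cp ?cm ?mulrDr//; exact: bddZ.
- rewrite (_ : (fun u => _) = (fun u => 2^-1 * cos (phase (zeta - eta) u) -
      2^-1 * cos (phase (zeta + eta) u))); last first.
    by apply/funext => u; rewrite !phaseDl phaseNl cosB cosD; field.
  by rewrite (meanB mJ) ?(meanZ mJ)// ?cp ?cm ?mulrBr//; exact: bddZ.
- rewrite (_ : (fun u => _) = (fun u => 2^-1 * sin (phase (zeta + eta) u) -
      2^-1 * sin (phase (zeta - eta) u))); last first.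
    by apply/funext => u; rewrite !phaseDl phaseNl sinB sinD; field.
  by rewrite (meanB mJ) ?(meanZ mJ)// ?sp ?sm ?mulr0 ?subrr//; exact: bddZ.
- rewrite (_ : (fun u => _) = (fun u => 2^-1 * sin (phase (zeta + eta) u) +
      2^-1 * sin (phase (zeta - eta) u))); last first.
    by apply/funext => u; rewrite !phaseDl phaseNl sinB sinD; field.
  by rewrite (meanD mJ) ?(meanZ mJ)// ?sp ?sm ?mulr0 ?addr0//; exact: bddZ.
Qed.

End Orthogonality.

(** * Minimality and the spectral decomposition *)

Section Takahashi.
Context {R : realType} {n p : nat}.
Variables (B : 'M[R]_n) (x : 'rV[R]_n -> 'rV[R]_p).
Hypotheses (n_gt0 : (0 < n)%N) (Bunit : B \in unitmx).
Hypotheses (x_smooth : smooth x) (x_per : lattice_per B x).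
Hypotheses (x_sphere : in_sphere x) (x_isometric : isometric x).
Implicit Types (u v w : 'rV[R]_n).

Lemma dotvE (k : nat) (a b : 'rV[R]_k) : dotv a b = (a *m b^T) 0 0.
Proof. by rewrite mxE; apply: eq_bigr => i _; rewrite mxE. Qed.

Lemma isometric_dotv v w u : dotv ('D_v x u) ('D_w x u) = dotv v w.
Proof.
have dx := smooth_differentiable u x_smooth.
rewrite !deriveEjacobian// dotvE trmx_mul mulmxA -(mulmxA v) -/(induced_metric x u).
by rewrite x_isometric mulmx1 -dotvE.
Qed.

Lemma dotv_derive_pos v u : dotv ('D_v x u) (x u) = 0.
Proof.
have := derive_dotv u v x_smooth x_smooth.
rewrite (_ : (fun u => _) = cst 1) ?derive_cst; last exact/funext.
by rewrite (dotvC (x u)) -mulr2n => /esym/eqP; rewrite mulrn_eq0 => /eqP.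
Qed.

Lemma dotv_derive2_pos v u : dotv ('D_v (fun u => 'D_v x u) u) (x u) = - dotv v v.
Proof.
have := derive_dotv u v (smooth_derive v x_smooth) x_smooth.
rewrite (_ : (fun u => _) = cst 0) ?derive_cst; last first.
  by apply/funext => w; rewrite dotv_derive_pos.
by rewrite isometric_dotv => /esym/eqP; rewrite addr_eq0 => /eqP.
Qed.

(* The flat metric has vanishing Christoffel symbols. *)
Lemma dotv_derive2_derive v w u :
  dotv ('D_v (fun u => 'D_v x u) u) ('D_w x u) = 0.
Proof.
have [J mJ] := exists_mean B.
have sv := smooth_derive v x_smooth; have sw := smooth_derive w x_smooth.
have cst0 v1 v2 v3 : 'D_v3 (fun u => dotv ('D_v1 x u) ('D_v2 x u)) u = 0.
  rewrite (_ : (fun u => _) = cst (dotv v1 v2)) ?derive_cst//.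
  by apply/funext => u'; rewrite isometric_dotv.
have h1 := etrans (esym (derive_dotv u v sv sw)) (cst0 v w v).
have h2 := etrans (esym (derive_dotv u w sv sv)) (cst0 v v w).
have h3 := derive_comm n_gt0 Bunit mJ v w u x_smooth x_per.
(* Here [a], [d], [e] stand for the second derivatives along [v v], [v w] and [w v], and [b], [c]
   for the first ones along [v] and [w]. Constancy of [|D_v x|^2] kills [b . e], which equals
   [b . d], so only [a . c] remains. *)
have alg (a b c d e : 'rV[R]_p) : dotv a c + dotv b d = 0 -> d = e ->
    dotv e b + dotv b e = 0 -> dotv a c = 0.
  move=> h de; move: h; rewrite de (dotvC e) -mulr2n => h /eqP.
  by rewrite mulrn_eq0 /= => /eqP h'; rewrite h' addr0 in h.
exact: alg h1 h3 h2.
Qed.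

(** Each pure second derivative has no tangential part and component -1 along [x u], so the diagonal
    second fundamental form is that derivative plus [x u]; minimality says that these sum to 0. *)
Lemma takahashi : minimal x -> forall u,
  \sum_i 'D_(delta_mx 0 i) (fun u => 'D_(delta_mx 0 i) x u) u = - n%:R *: x u.
Proof.
move=> x_min u; have := x_min u; rewrite /mean_curvature x_isometric invmx1.
move=> /eqP; rewrite scaler_eq0 invr_eq0 pnatr_eq0 -leqn0 leqNgt n_gt0 /=.
have np i : \sum_j (1%:M : 'M[R]_n) i j *: second_form x u i j =
    'D_(delta_mx 0 i) (fun u => 'D_(delta_mx 0 i) x u) u + x u.
  rewrite (bigD1 i)//= big1 ?addr0 => [|j ji]; last first.
    by rewrite mxE eq_sym (negbTE ji) scale0r.
  rewrite mxE eqxx scale1r /second_form /normal_part x_isometric invmx1 mulmx1.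
  rewrite dotv_derive2_pos dotv_delta mxE !eqxx scaleN1r opprK.
  rewrite (_ : _ *m ('J x u)^T = 0) ?mul0mx ?subr0//.
  apply/rowP => k; rewrite mxE [RHS]mxE -[RHS](dotv_derive2_derive (delta_mx 0 i) (delta_mx 0 k) u).
  apply: eq_bigr => l _; rewrite mxE; congr (_ * _).
  by rewrite deriveEjacobian -?rowE ?mxE//; exact: smooth_differentiable.
under eq_bigr do rewrite np.
rewrite big_split /= sumr_const card_ord addr_eq0 => /eqP ->.
by rewrite scaleNr scaler_nat.
Qed.

End Takahashi.

(** * Trigonometric expansion over one eigenvalue *)

Section Expansion.
Context {R : realType} {n p : nat}.
Variables (B : 'M[R]_n) (J : ('rV[R]_n -> R) -> R).
Hypotheses (n_gt0 : (0 < n)%N) (Bunit : B \in unitmx) (mJ : is_mean B J).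
Variables (x : 'rV[R]_n -> 'rV[R]_p) (lam : R).
Hypotheses (x_smooth : smooth x) (x_per : lattice_per B x).
Hypothesis x_eigen : forall u,
  \sum_i 'D_(delta_mx 0 i) (fun u => 'D_(delta_mx 0 i) x u) u = - lam *: x u.
Variables (N : nat) (xi : 'I_N -> 'rV[R]_n).
Hypothesis lam_gt0 : 0 < lam.
Hypothesis xi_all : enumerates_up_to_sign
  [set eta : 'rV[R]_n | is_dual B eta /\ 4 * pi ^+ 2 * dotv eta eta = lam] xi.

(** Integrating the Laplacian by parts twice multiplies the coefficient at [eta] by
    [- 4 pi^2 |eta|^2], while the eigenvalue equation multiplies it by [- lam]. *)
Lemma eigen_coef0 a eta : is_dual B eta -> 4 * pi ^+ 2 * dotv eta eta != lam ->
  J (fun u => x u 0 a * cos (phase eta u)) = 0 /\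
  J (fun u => x u 0 a * sin (phase eta u)) = 0.
Proof.
move=> de ne; pose D i := fun u => 'D_(delta_mx 0 i : 'rV[R]_n) x u.
have sD i : smooth (D i) by exact: smooth_derive.
have pD i : lattice_per B (D i) by exact: latper_derive.
have bDD i : bdd (fun u => 'D_(delta_mx 0 i) (D i) u 0 a).
  by apply: (smooth_bdd Bunit); [exact: smooth_derive|exact: latper_derive].
have bx : bdd (fun u => x u 0 a) by exact: (smooth_bdd Bunit).
have e u : \sum_i 'D_(delta_mx 0 i) (D i) u 0 a = - lam * x u 0 a.
  by rewrite -summxE x_eigen mxE.
have ph : \sum_i phase eta (delta_mx 0 i) ^+ 2 = 4 * pi ^+ 2 * dotv eta eta.
  rewrite /dotv mulr_sumr; apply: eq_bigr => i _.
  by rewrite /phase dotv_delta; ring.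
have ne' : lam - 4 * pi ^+ 2 * dotv eta eta != 0 by rewrite subr_eq0 eq_sym.
split; apply: (mulfI ne'); rewrite mulr0 mulrBl; apply/eqP; rewrite subr_eq0; apply/eqP.
  transitivity (- J (fun u => \sum_i 'D_(delta_mx 0 i) (D i) u 0 a * cos (phase eta u))).
    under [in RHS]eq_fun do rewrite -mulr_suml e -mulrA.
    by rewrite (meanZ mJ) ?mulNr ?opprK//; exact: bddM.
  rewrite (mean_sum mJ) => [|i]; last exact: bddM.
  rewrite -ph mulr_suml -sumrN; apply: eq_bigr => i _.
  have [-> _] := fourier_derive Bunit mJ (delta_mx 0 i) a (sD i) (pD i) de.
  have [_ ->] := fourier_derive Bunit mJ (delta_mx 0 i) a x_smooth x_per de.
  by ring.
transitivity (- J (fun u => \sum_i 'D_(delta_mx 0 i) (D i) u 0 a * sin (phase eta u))).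
  under [in RHS]eq_fun do rewrite -mulr_suml e -mulrA.
  by rewrite (meanZ mJ) ?mulNr ?opprK//; exact: bddM.
rewrite (mean_sum mJ) => [|i]; last exact: bddM.
rewrite -ph mulr_suml -sumrN; apply: eq_bigr => i _.
have [_ ->] := fourier_derive Bunit mJ (delta_mx 0 i) a (sD i) (pD i) de.
have [-> _] := fourier_derive Bunit mJ (delta_mx 0 i) a x_smooth x_per de.
by ring.
Qed.

Lemma xi_neq0 j : xi j != 0.
Proof.
apply/eqP => x0; have [/(_ j)[_ /eqP]] := xi_all.
by rewrite x0 dotv0l mulr0 lt_eqF.
Qed.

(** The uniqueness clause for [xi i] turns either relation into [i = j]; an opposite pair would then
    give [2 *: xi i = 0]. *)
Lemma xi_sign_inj i j : (xi i == xi j) = (i == j) /\ (xi i == - xi j) = false.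
Proof.
have [xiA xiU] := xi_all; have [k [_ kU]] := xiU _ (xiA i).
have ki := kU i (or_introl erefl).
split.
  apply/eqP/eqP => [e|->//]; have := kU j (or_introl e); by rewrite -ki.
apply/eqP => e; have kj := kU j (or_intror e); move: e; rewrite -kj ki => e.
have /eqP := xi_neq0 i; apply; apply/eqP.
have /eqP := e; rewrite -addr_eq0 -mulr2n => /eqP h.
have : (2 : R) *: xi i = 0 by rewrite scaler_nat.
by move=> /eqP; rewrite scaler_eq0 pnatr_eq0.
Qed.

(** [fcos y eta - i fsin y eta] is the vector Fourier coefficient of [y] at [eta], kept as two real
    vectors. *)
Definition fcos (y : 'rV[R]_n -> 'rV[R]_p) eta : 'rV[R]_p :=
  \row_a J (fun u => y u 0 a * cos (phase eta u)).

Definition fsin (y : 'rV[R]_n -> 'rV[R]_p) eta : 'rV[R]_p :=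
  \row_a J (fun u => y u 0 a * sin (phase eta u)).

(** Both sides have the same Fourier coefficients; the factor 2 compensates the mean [1/2] of a
    squared cosine or sine. The map [y] is general because the expansion serves for [x] and for its
    first derivatives. *)
Lemma trig_expansion (y : 'rV[R]_n -> 'rV[R]_p) : smooth y -> lattice_per B y ->
  (forall eta, is_dual B eta -> 4 * pi ^+ 2 * dotv eta eta != lam ->
    fcos y eta = 0 /\ fsin y eta = 0) ->
  forall u, y u = \sum_j (cos (phase (xi j) u) *: (2 *: fcos y (xi j)) +
                          sin (phase (xi j) u) *: (2 *: fsin y (xi j))).
Proof.
move=> y_smooth y_per y_spec.
have [xiA xiU] := xi_all.
have bx a : bdd (fun u => y u 0 a) by exact: (smooth_bdd Bunit).
pose A j : 'rV[R]_p := 2 *: fcos y (xi j); pose C j : 'rV[R]_p := 2 *: fsin y (xi j).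
move=> u; apply/rowP => a; apply/eqP; rewrite -subr_eq0; apply/eqP; move: u.
pose S u := \sum_j (A j 0 a * cos (phase (xi j) u) + C j 0 a * sin (phase (xi j) u)).
pose h u := y u 0 a - S u.
have hE u : y u 0 a -
  (\sum_j (cos (phase (xi j) u) *: A j + sin (phase (xi j) u) *: C j)) 0 a = h u.
  rewrite /h; congr (_ - _); rewrite summxE; apply: eq_bigr => j _.
  by rewrite mxE [in LHS]mxE [X in _ + X]mxE [in LHS]mulrC [X in _ + X]mulrC.
move=> u; rewrite hE; move: u {hE}.
apply: (fourier_uniqueness n_gt0 Bunit mJ).
- move=> u; apply: continuousB; first exact: smooth_coord_continuous.
  apply: continuous_sum => j v.
  apply: (@continuousD _ _ _ (fun u => A j 0 a * cos (phase (xi j) u))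
     (fun u => C j 0 a * sin (phase (xi j) u))).
    apply: (@continuousM _ _ (fun=> A j 0 a) (fun u => cos (phase (xi j) u))).
      exact: cst_continuous.
    apply: continuous_comp; [exact: phase_continuous|exact: continuous_cos].
  apply: (@continuousM _ _ (fun=> C j 0 a) (fun u => sin (phase (xi j) u))).
    exact: cst_continuous.
  apply: continuous_comp; [exact: phase_continuous|exact: continuous_sin].
- move=> u z; rewrite /h y_per; congr (_ - _); apply: eq_bigr => j _.
  have [dj _] := xiA j; have [ec es] := latper_trig 0 dj.
  by have := ec u z; have := es u z; rewrite !addr0 => -> ->.
have bS : bdd S by apply: bdd_sum => j; apply: bddD; exact: bddZ.
split=> [|eta de]; first exact: bddB.
have SE : J (fun u => S u * cos (phase eta u)) = 
     \sum_j A j 0 a * (2^-1 * ((xi j == eta)%:R + (xi j == - eta)%:R)) /\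
   J (fun u => S u * sin (phase eta u)) = 
     \sum_j C j 0 a * (2^-1 * ((xi j == eta)%:R - (xi j == - eta)%:R)).
  rewrite /S; split; under eq_fun do rewrite mulr_suml.
    rewrite (mean_sum mJ) => [|j]; last by apply: bddM => //; apply: bddD; exact: bddZ.
    apply: eq_bigr => j _; have [dj _] := xiA j.
    have [cc ss cs sc] := mean_trig_mul Bunit mJ dj de.
    under eq_fun do rewrite mulrDl -!mulrA.
    rewrite (meanD mJ) ?(meanZ mJ) ?cc ?sc ?mulr0 ?addr0//;
      by [exact: bddM|apply: bddZ; exact: bddM].
  rewrite (mean_sum mJ) => [|j]; last by apply: bddM => //; apply: bddD; exact: bddZ.
  apply: eq_bigr => j _; have [dj _] := xiA j.
  have [cc ss cs sc] := mean_trig_mul Bunit mJ dj de.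
  under eq_fun do rewrite mulrDl -!mulrA.
  rewrite (meanD mJ) ?(meanZ mJ) ?ss ?cs ?mulr0 ?add0r//;
    by [exact: bddM|apply: bddZ; exact: bddM].
have bxc : bdd (fun u => y u 0 a * cos (phase eta u)) by exact: bddM.
have bxs : bdd (fun u => y u 0 a * sin (phase eta u)) by exact: bddM.
suff [Ec Es] : J (fun u => y u 0 a * cos (phase eta u)) = J (fun u => S u * cos (phase eta u))
   /\ J (fun u => y u 0 a * sin (phase eta u)) = J (fun u => S u * sin (phase eta u)).
  rewrite /h; split; under eq_fun do rewrite mulrBl;
    by rewrite (meanB mJ) ?Ec ?Es ?subrr//; exact: bddM.
rewrite SE.1 SE.2 {SE}.
have [le|ne] := eqVneq (4 * pi ^+ 2 * dotv eta eta) lam; last first.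
  have [/rowP/(_ a) yc /rowP/(_ a) ys] := y_spec eta de ne.
  rewrite !mxE in yc ys; rewrite yc ys.
  have no j : (xi j == eta) = false /\ (xi j == - eta) = false.
    have [_ lj] := xiA j; split; apply/eqP => e; move: ne; rewrite -lj e.
      by rewrite eqxx.
    by rewrite dotvNl dotvNr opprK eqxx.
  by split; rewrite big1// => j _; have [-> ->] := no j; rewrite ?addr0 ?subr0 !mulr0.
have [k [ke kU]] := xiU eta (conj de le).
(* Only the index [k] with [eta = +- xi k] contributes; [G] is the sum for the cosine and the
   difference for the sine. *)
have oth (F : 'I_N -> R) (G : R -> R -> R) : G 0 0 = 0 ->
    \sum_j F j * (2^-1 * G (xi j == eta)%:R (xi j == - eta)%:R) =
    F k * (2^-1 * G (xi k == eta)%:R (xi k == - eta)%:R).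
  move=> G0; rewrite (bigD1 k)//= big1 ?addr0// => j jk.
  suff [-> ->] : (xi j == eta) = false /\ (xi j == - eta) = false.
    by rewrite G0 !mulr0.
  by split; apply/eqP => e; move: jk; rewrite -(kU j) ?eqxx// e ?opprK; tauto.
rewrite (oth _ (fun a b => a + b)) ?addr0// (oth _ (fun a b => a - b)) ?subrr//.
have [eq1 eq2] := xi_sign_inj k k; rewrite eqxx in eq1.
have half1 (t : R) : t = 2 * t * (2^-1 * 1) by field.
case: ke => ->; rewrite ?opprK ?eqxx ?eq2 /A /C !mxE ?addr0 ?subr0 ?add0r ?sub0r.
  by split; exact: half1.
split; first by under eq_fun do rewrite phaseNl cosN; exact: half1.
under eq_fun do rewrite phaseNl sinN mulrN.
rewrite (meanN mJ); last exact: bddM.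
by rewrite !mulrN -half1.
Qed.

End Expansion.

(** * Unimodular families *)

Section Gram.
Context {R : realType} {n : nat}.

(** One Gram-Schmidt step on the first row: with [r] its component orthogonal to the other rows, the
    Gram determinant is [|r|^2] times that of the other rows, and freeness gives [r != 0]. *)
Lemma gram_det_gt0 k (M : 'M[R]_(k, n)) : row_free M -> 0 < \det (M *m M^T).
Proof.
elim: k M => [|k IH] M; first by rewrite det_mx00 ltr01.
rewrite -[k.+1]/(1 + k)%N in M *.
pose m := usubmx M; pose M' := dsubmx M.
have ME : M = col_mx m M' by rewrite vsubmxK.
move=> fM; have /row_freeP[D MD] := fM.
have fM' : row_free M'.
  apply/row_freeP; exists (D *m col_mx 0 1%:M); rewrite mulmxA.
  have -> : M' *m D = dsubmx (M *m D) by rewrite ME mul_col_mx col_mxKd.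
  by rewrite MD scalar_mx_block block_mxEv col_mxKd mul_row_col mulmx0 mulmx1 add0r.
have G0 := IH _ fM'; set G := M' *m M'^T in G0.
have Gu : G \in unitmx by rewrite unitmxE unitfE lt0r_neq0.
pose a := m *m M'^T *m invmx G; pose r := m - a *m M'.
have rM' : r *m M'^T = 0.
  by rewrite mulmxBl -(mulmxA a) -/G /a mulmxKV// subrr.
have ME' : M = block_mx 1%:M a 0 1%:M *m col_mx r M'.
  by rewrite mul_block_col !mul1mx mul0mx add0r subrK -ME.
have r0 : r != 0.
  apply/eqP => r0; have : row_mx 1%:M (- a) *m M = 0.
    by rewrite ME' mulmxA mul_row_block !mulmx1 mul1mx addrN mul_row_col r0 mulmx0 mul0mx addr0.
  move/eqP; rewrite mulmx_free_eq0// => /eqP /matrixP /(_ 0 (lshift k 0)).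
  by rewrite row_mxEl !mxE => /eqP; rewrite oner_eq0.
have -> : \det (M *m M^T) = dotv r r * \det G.
  rewrite ME' trmx_mul mulmxA -(mulmxA (block_mx _ _ _ _)) !det_mulmx det_tr.
  rewrite !det_ublock !det1 !mulr1 mul1r tr_col_mx mul_col_row -/G rM'.
  have -> : M' *m r^T = 0 by rewrite -[LHS]trmxK trmx_mul trmxK rM' trmx0.
  by rewrite det_ublock det_mx11 dotvE.
by rewrite mulr_gt0// lt0r dotvv_ge0 dotvv_eq0 r0.
Qed.

Lemma volume_mul k (P : 'M[R]_k) (M : 'M[R]_(k, n)) :
  volume (P *m M) = `|\det P| * volume M.
Proof.
rewrite /volume trmx_mul mulmxA -(mulmxA P) !det_mulmx det_tr mulrAC -expr2.
by rewrite sqrtrM ?sqr_ge0// sqrtr_sqr.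
Qed.

End Gram.

Section Unimodular.
Context {R : realType} {n N : nat}.
Variable xi : 'I_N -> 'rV[R]_n.
Hypothesis xi_uni : unimodular xi.

Definition signed (eta : 'rV[R]_n) : Prop :=
  exists j, eta = xi j \/ eta = - xi j.

(** Sign changes of rows are a product with a diagonal matrix of determinant [+-1], which preserves
    volume and freeness; this reduces to members of the family itself. *)
Lemma signed_volume (M1 M2 : 'M[R]_(\rank (\matrix_(j < N) xi j), n)) :
  (forall i, signed (row i M1)) -> (forall i, signed (row i M2)) ->
  row_free M1 -> row_free M2 -> volume M1 = volume M2.
Proof.
have norm (M : 'M[R]_(\rank (\matrix_(j < N) xi j), n)) :
  (forall i, signed (row i M)) -> row_free M ->
  exists2 s, row_free (\matrix_i xi (s i)) & 
    volume M = volume (\matrix_(i < \rank (\matrix_(j < N) xi j)) xi (s i)).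
  move=> sM fM; pose s i := sval (cid (sM i)).
  have sP i : row i M = xi (s i) \/ row i M = - xi (s i) := svalP (cid (sM i)).
  pose d : 'rV[R]_(\rank (\matrix_(j < N) xi j)) :=
    \row_i (if row i M == xi (s i) then 1 else -1).
  have dP i : d 0 i = 1 \/ d 0 i = -1 by rewrite mxE; case: ifP; [left|right].
  have e : \matrix_i xi (s i) = diag_mx d *m M.
    apply/row_matrixP => i; rewrite rowK row_mul row_diag_mx -scalemxAl -rowE mxE.
    case: ifPn => [/eqP <-|ne]; first by rewrite scale1r.
    by case: (sP i) ne => ->; rewrite ?eqxx// scaleN1r opprK.
  have dd : `|\det (diag_mx d)| = 1.
    rewrite det_diag normr_prod big1// => i _.
    by case: (dP i) => ->; rewrite ?normrN normr1.
  have ud : diag_mx d \in unitmx.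
    by rewrite unitmxE unitfE -normr_eq0 dd oner_eq0.
  exists s; last by rewrite e volume_mul dd mul1r.
  by rewrite e /row_free (eqmxMfull _ _) ?row_full_unit.
move=> h1 h2 f1 f2; have [s1 fs1 ->] := norm _ h1 f1.
by have [s2 fs2 ->] := norm _ h2 f2; exact: xi_uni.
Qed.

(** Cramer's rule: exchanging row [i] of [M] for [c *m M] multiplies the volume by [|c_i|]. If
    [c_i != 0] the new rows are still free, so unimodularity gives [|c_i| = 1]. *)
Lemma signed_coord k (M : 'M[R]_(k, n)) (c : 'rV[R]_k) i :
  k = \rank (\matrix_(j < N) xi j) ->
  (forall i, signed (row i M)) -> row_free M -> signed (c *m M) ->
  [\/ c 0 i = 0, c 0 i = 1 | c 0 i = -1].
Proof.
move=> ek; subst k => sM fM sc.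
have [c0|c0] := eqVneq (c 0 i) 0; first by constructor 1.
pose P : 'M[R]__ := \matrix_j (if j == i then c else row j 1%:M).
have PM j : row j (P *m M) = if j == i then c *m M else row j M.
  by rewrite row_mul rowK; case: ifP => // _; rewrite -row_mul mul1mx.
have dP : \det P = c 0 i.
  rewrite (expand_det_col P i) (bigD1 i)//= big1 ?addr0 => [|j ji]; last first.
    by rewrite mxE (negbTE ji) !mxE (negbTE ji) mul0r.
  rewrite mxE eqxx /cofactor addnn -signr_odd odd_double expr0 mul1r.
  rewrite (_ : row' i (col' i P) = 1%:M) ?det1 ?mulr1//.
  apply/matrixP => j l; rewrite !mxE eq_sym (negbTE (neq_lift _ _)) !mxE.
  by rewrite (inj_eq lift_inj).
have uP : P \in unitmx by rewrite unitmxE unitfE dP.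
have fPM : row_free (P *m M) by rewrite /row_free (eqmxMfull _ _) ?row_full_unit.
have sPM j : signed (row j (P *m M)) by rewrite PM; case: ifP.
have := signed_volume sPM sM fPM fM; rewrite volume_mul dP -[RHS]mul1r.
have v0 : volume M != 0 by rewrite lt0r_neq0// sqrtr_gt0 gram_det_gt0.
move=> /(mulIf v0) /eqP; rewrite eqr_norml ler01 andbT => /orP[] /eqP.
  by constructor 2.
by constructor 3.
Qed.

End Unimodular.

(** * Bases adapted to a pair of frequencies *)

Section Separation.
Context {R : realType} {n N : nat}.
Variable xi : 'I_N -> 'rV[R]_n.
Hypothesis xi_uni : unimodular xi.

(** Greedy choice: a vector of [Z] is kept unless it already lies in the current span. *)
Lemma extend_free (X Z : seq 'rV[R]_n) : free X ->
  exists Z', [/\ {subset Z' <= Z}, free (Z' ++ X) &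
    forall z, z \in Z -> z \in <<Z' ++ X>>%VS].
Proof.
elim: Z X => [|z Z IH] X fX; first by exists [::].
have [zX|zX] := boolP (z \in <<X>>%VS).
  have [Z' [sZ' fZ' spZ']] := IH X fX; exists Z'; split=> //.
    by move=> w /sZ' wZ; rewrite inE wZ orbT.
  move=> w; rewrite inE => /orP[/eqP ->|/spZ'//].
  by apply: subvP zX; apply: sub_span => t; rewrite mem_cat orbC => ->.
have [|Z' [sZ' fZ' spZ']] := IH (z :: X); first by rewrite free_cons zX.
exists (rcons Z' z); rewrite cat_rcons; split=> //.
  by move=> w; rewrite mem_rcons !inE => /orP[->//|/sZ' ->]; rewrite orbT.
move=> w; rewrite inE => /orP[/eqP ->|/spZ'//].
by apply: memv_span; rewrite mem_cat inE eqxx orbT.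
Qed.

Definition row_seq (b : seq 'rV[R]_n) : 'M[R]_(size b, n) :=
  \matrix_(i < size b) b`_i.

Lemma mul_row_seq (b : seq 'rV[R]_n) (c : 'rV[R]_(size b)) :
  c *m row_seq b = \sum_i c 0 i *: b`_i.
Proof. by rewrite mulmx_sum_row; apply: eq_bigr => i _; rewrite rowK. Qed.

Lemma row_free_seq (b : seq 'rV[R]_n) : free b -> row_free (row_seq b).
Proof.
move=> fb; rewrite -kermx_eq0; apply/eqP/row_matrixP => i; rewrite row0.
have : row i (kermx (row_seq b)) *m row_seq b = 0 by rewrite -row_mul mulmx_ker row0.
move: (row i _) => c; rewrite mul_row_seq => c0; apply/rowP => j; rewrite [RHS]mxE.
by have /freeP -> := fb : free (in_tuple b).
Qed.

Lemma span_row_seq (b : seq 'rV[R]_n) v : v \in <<b>>%VS ->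
  exists c, v = c *m row_seq b.
Proof.
move=> vb; exists (\row_i coord (in_tuple b) i v); rewrite mul_row_seq.
by rewrite {1}(coord_span (X := in_tuple b) vb); apply: eq_bigr => i _; rewrite mxE.
Qed.

Lemma size_basis (b : seq 'rV[R]_n) : free b ->
  (forall v, v \in b -> signed xi v) -> (forall j, xi j \in <<b>>%VS) ->
  size b = \rank (\matrix_(j < N) xi j).
Proof.
move=> fb sb xib; have /eqP <- := row_free_seq fb; apply/eqP.
rewrite eqn_leq !mxrankS//; apply/row_subP => i; rewrite rowK.
  by have [c ->] := span_row_seq (xib i); exact: submxMl.
have [j bj] := sb _ (mem_nth 0 (ltn_ord i)).
have xj : (xi j <= \matrix_(j < N) xi j)%MS by rewrite -[xi j](rowK xi) row_sub.
by case: bj => ->; rewrite ?eqmx_opp.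
Qed.

(* The change of coordinates when the basis vector b_l is exchanged with
   b_i1 + b_i2 - b_l. *)
Definition swap_mx k (i1 i2 l : 'I_k) : 'M[R]_k :=
  1%:M + (delta_mx l 0 : 'cV[R]_k) *m
    (delta_mx 0 i1 + delta_mx 0 i2 - 2 *: delta_mx 0 l : 'rV[R]_k).

Lemma mul_swap_mx k (i1 i2 l : 'I_k) (c : 'rV[R]_k) :
  c *m swap_mx i1 i2 l =
  c + c 0 l *: (delta_mx 0 i1 + delta_mx 0 i2 - 2 *: delta_mx 0 l).
Proof.
rewrite mulmxDr mulmx1 mulmxA -colE; congr (_ + _).
have -> : col l c = (c 0 l)%:M.
  by apply/matrixP => i j; rewrite !ord1 !mxE eqxx mulr1n.
by rewrite mul_scalar_mx.
Qed.

(** A matrix [1 + e_l r] with [r_l = -2] is a reflection. *)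
Lemma swap_mxK k (i1 i2 l : 'I_k) : i1 != l -> i2 != l ->
  swap_mx i1 i2 l *m swap_mx i1 i2 l = 1%:M.
Proof.
move=> n1 n2; apply/row_matrixP => i.
have rl : (delta_mx 0 i1 + delta_mx 0 i2 - 2 *: delta_mx 0 l : 'rV[R]_k) 0 l = -2.
  rewrite !mxE eqxx /= (eq_sym l i1) (eq_sym l i2) (negbTE n1) (negbTE n2) eqxx /=.
  by ring.
rewrite row_mul [row i (swap_mx _ _ _)]rowE row1 !mul_swap_mx.
move: (_ + _ - _ : 'rV[R]_k) (delta_mx 0 i : 'rV[R]_k) rl => r c rl.
have -> : (c + c 0 l *: r) 0 l = - c 0 l by rewrite !mxE rl; ring.
by rewrite scaleNr addrK.
Qed.

Section Coordinates.
Variables (k : nat) (M : 'M[R]_(k, n)) (i1 i2 : 'I_k) (omega : 'rV[R]_n).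
Hypothesis ek : k = \rank (\matrix_(j < N) xi j).
Hypotheses (sM : forall i, signed xi (row i M)) (fM : row_free M).
Hypotheses (i12 : i1 != i2) (omegaE : omega = row i1 M + row i2 M).

Lemma omega_coord : omega = (delta_mx 0 i1 + delta_mx 0 i2) *m M.
Proof. by rewrite mulmxDl -!rowE. Qed.

(** The coordinates of the two members of the pair are [c_i] and [1 - c_i]; both lie in [{-1, 0, 1}]
    by [signed_coord]. *)
Lemma pair_coord01 (c : 'rV[R]_k) i : i = i1 \/ i = i2 ->
  signed xi (c *m M) -> signed xi (omega - c *m M) -> c 0 i = 0 \/ c 0 i = 1.
Proof.
move=> ii sc; rewrite omega_coord -mulmxBl => so.
have e : (delta_mx 0 i1 + delta_mx 0 i2 - c) 0 i = 1 - c 0 i.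
  rewrite !mxE; congr (_ - _); case: ii => ->; rewrite !eqxx /=.
    by rewrite (negbTE i12) addr0.
  by rewrite eq_sym (negbTE i12) add0r.
have := signed_coord xi_uni i ek sM fM so; rewrite e.
have [->|->|->] := signed_coord xi_uni i ek sM fM sc; [by left|by right|].
by rewrite opprK; case=> h; exfalso; move: h; lra.
Qed.

(** Once row [l] is exchanged for [omega - row l M], the first coordinate of [c *m M] becomes
    [1 + c_l] and the second one of [omega - c *m M] becomes [1 - c_l]. Both lie in [{-1, 0, 1}],
    which leaves only [c_l = 0]. *)
Lemma swap_coord0 (c : 'rV[R]_k) l : l != i1 -> l != i2 ->
  signed xi (omega - row l M) -> signed xi (c *m M) ->
  signed xi (omega - c *m M) -> c 0 i1 = 1 -> c 0 i2 = 0 -> c 0 l = 0.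
Proof.
move=> l1 l2 sl sc so c1 c2.
pose P := swap_mx i1 i2 l.
have PP : P *m P = 1%:M by apply: swap_mxK; rewrite eq_sym.
have [_ Pu] := mulmx1_unit PP.
have fPM : row_free (P *m M) by rewrite /row_free (eqmxMfull _ _) ?row_full_unit.
have rP i : row i (P *m M) = if i == l then omega - row l M else row i M.
  rewrite row_mul [row i P]rowE mul_swap_mx mxE eqxx /= eq_sym.
  have [->|il] := eqVneq i l; last by rewrite scale0r addr0 -rowE.
  rewrite scale1r omega_coord [row l M]rowE -mulmxBl; congr (_ *m _).
  by rewrite addrC scaler_nat mulr2n opprD addrA subrK.
have sPM i : signed xi (row i (P *m M)) by rewrite rP; case: ifP.
have cPM (d : 'rV[R]_k) : d *m M = (d *m P) *m (P *m M).
  by rewrite mulmxA -(mulmxA d) PP mulmx1.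
have n12 := negbTE i12; have nl1 := negbTE l1; have nl2 := negbTE l2.
have n21 : (i2 == i1) = false by rewrite eq_sym.
have n1l : (i1 == l) = false by rewrite eq_sym.
have n2l : (i2 == l) = false by rewrite eq_sym.
have h1 : (c *m P) 0 i1 = 1 + c 0 l.
  by rewrite mul_swap_mx !mxE c1 !eqxx ?(n12, n1l) /=; ring.
have h2 : ((delta_mx 0 i1 + delta_mx 0 i2 - c) *m P) 0 i2 = 1 - c 0 l.
  by rewrite mul_swap_mx !mxE c2 !eqxx ?(n21, n2l, nl1, nl2) /=; ring.
move: sc so; rewrite omega_coord -mulmxBl (cPM c) (cPM (_ - c)) => sc so.
have := signed_coord xi_uni i1 ek sPM fPM sc.
have := signed_coord xi_uni i2 ek sPM fPM so.
by rewrite h1 h2; case=> h; case=> h'; lra.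
Qed.

End Coordinates.

End Separation.

Section SeparatingPair.
Context {R : realType} {n N : nat}.
Variables (xi : 'I_N -> 'rV[R]_n) (len : R).
Hypothesis xi_uni : unimodular xi.
Hypotheses (len_gt0 : 0 < len) (xi_len : forall j, dotv (xi j) (xi j) = len).

Lemma signed_len eta : signed xi eta -> dotv eta eta = len.
Proof. by move=> [j [->|->]]; rewrite ?dotvNl ?dotvNr ?opprK xi_len. Qed.

Lemma free_signed_pair eta1 eta2 : signed xi eta1 -> signed xi eta2 ->
  eta1 != eta2 -> eta1 + eta2 != 0 -> free [:: eta1; eta2].
Proof.
move=> /signed_len s1 /signed_len s2 ne nz.
rewrite free_cons seq1_free; apply/andP; split; last first.
  by rewrite -dotvv_eq0 s2 lt0r_neq0.
rewrite span_seq1; apply/vlineP => -[a e].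
have : a ^+ 2 == 1.
  move: s1; rewrite e dotvZl dotvZr s2 mulrA -expr2 -[RHS]mul1r.
  by move=> /(mulIf (lt0r_neq0 len_gt0)) ->.
rewrite sqrf_eq1 => /orP[] /eqP a1; move: ne nz; rewrite e a1.
  by rewrite scale1r eqxx.
by rewrite scaleN1r addNr eqxx.
Qed.

(** Strict convexity of the sphere: [eta1] is the midpoint of [eta] and [2 eta1 - eta], and all
    three have the same length. *)
Lemma pair_of_double eta1 eta : signed xi eta1 -> signed xi eta ->
  signed xi (eta1 + eta1 - eta) -> eta = eta1.
Proof.
move=> /signed_len s1 /signed_len s /signed_len so; apply/eqP.
rewrite -subr_eq0 -dotvv_eq0; move: so.
rewrite !(dotvDl, dotvDr, dotvNl, dotvNr) (dotvC eta eta1) s s1 => so.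
by apply/eqP; lra.
Qed.

(** The covectors [f] and [g] read the coordinates along [eta1] and [eta2] in an adapted basis. As
    weights in a convolution sum over pairs of sum [eta1 + eta2], they isolate the single term at
    [eta1]. *)
Lemma separating_pair eta1 eta2 : signed xi eta1 -> signed xi eta2 ->
  eta1 + eta2 != 0 -> exists f g, forall eta, signed xi eta ->
  signed xi (eta1 + eta2 - eta) ->
  dotv eta f * dotv (eta1 + eta2 - eta) g = (eta == eta1)%:R.
Proof.
move=> s1 s2 nz; have [e12|ne] := eqVneq eta1 eta2.
  subst eta2; exists (len^-1 *: eta1), (len^-1 *: eta1) => eta s so.
  rewrite (pair_of_double s1 s so) eqxx addrK !dotvZr signed_len//.
  by rewrite mulVf ?mulr1// lt0r_neq0.
set omega := eta1 + eta2 in nz *.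
pose Y := [seq xi j | j : 'I_N] ++ [seq - xi j | j : 'I_N].
have YP eta : reflect (signed xi eta) (eta \in Y).
  rewrite mem_cat; apply: (iffP orP) => [[/codomP|/codomP] [j ->]|[j [->|->]]].
  - by exists j; left.
  - by exists j; right.
  - by left; exact: codom_f.
  - by right; apply/codomP; exists j.
(* [P] lists the members of pairs of sum [omega]. The basis [b] is built from the right:
   [eta1, eta2], then vectors [Z1] of [P] until [P] is spanned, then vectors [Z2] of [Y]. *)
pose P := [seq e <- Y | omega - e \in Y].
have f0 := free_signed_pair s1 s2 ne nz.
have [Z1 [sZ1 fZ1 spZ1]] := extend_free P f0.
set W := Z1 ++ _ in fZ1 spZ1.
have [Z2 [sZ2 fb spb]] := extend_free Y fZ1.
set b := Z2 ++ W in fb spb.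
have b_uniq := free_uniq fb.
have sb v : v \in b -> signed xi v.
  rewrite !mem_cat => /or3P[/sZ2/YP//|/sZ1|]; last first.
    by rewrite !inE => /orP[] /eqP ->.
  by rewrite mem_filter => /andP[_ /YP].
have xib j : xi j \in <<b>>%VS by apply: spb; apply/YP; exists j; left.
have ek := size_basis fb sb xib.
pose M := row_seq b; have fM : row_free M := row_free_seq fb.
have rM i : row i M = b`_i by rewrite rowK.
have sM i : signed xi (row i M) by rewrite rM; apply/sb/mem_nth.
have b1 : eta1 \in b by rewrite !mem_cat !inE eqxx !orbT.
have b2 : eta2 \in b by rewrite !mem_cat !inE eqxx !orbT.
have lt1 := b1; rewrite -index_mem in lt1; pose i1 := Ordinal lt1.
have lt2 := b2; rewrite -index_mem in lt2; pose i2 := Ordinal lt2.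
have r1 : row i1 M = eta1 by rewrite rM nth_index.
have r2 : row i2 M = eta2 by rewrite rM nth_index.
have i12 : i1 != i2 by apply: contra ne => /eqP e; rewrite -r1 -r2 e.
have omE : omega = row i1 M + row i2 M by rewrite r1 r2.
have /row_freeP[D MD] := fM.
have KD (c : 'rV[R]_(size b)) : c *m M *m D = c by rewrite -mulmxA MD mulmx1.
(* [D] is a right inverse of [M], so pairing with [f i] gives the coordinate on the [i]-th basis
   vector for any vector in the span of [b]. *)
pose f i : 'rV[R]_n := (col i D)^T.
have fE eta i : dotv eta (f i) = (eta *m D) 0 i.
  by rewrite dotvE trmxK colE mulmxA -colE mxE.
exists (f i1), (f i2) => eta s so; rewrite !fE mulmxBl.
have -> (a a' : 'rV[R]_(size b)) i : (a - a') 0 i = a 0 i - a' 0 i by rewrite !mxE.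
have -> : (omega *m D) 0 i2 = 1.
  rewrite (omega_coord omE) KD !mxE !eqxx /= eq_sym (negbTE i12) add0r//.
have [c cE] : exists c, eta = c *m M by apply: span_row_seq; apply/spb/YP.
rewrite {1 2}cE KD.
rewrite cE in s so.
(* The product is [c_i1 * (1 - c_i2)] with both coordinates 0 or 1. It is nonzero only for [(1, 0)],
   the coordinates of [eta1]; the other three cases exclude [eta = eta1]. *)
have [c1|c1] := pair_coord01 xi_uni ek sM fM i12 omE (or_introl erefl) s so;
  have [c2|c2] := pair_coord01 xi_uni ek sM fM i12 omE (or_intror erefl) s so;
  rewrite c1 c2; last 1 first.
- rewrite subrr mulr0; case: eqP => // e; exfalso.
  move: c2; rewrite -(KD c) -cE e -r1 [row i1 M]rowE KD !mxE.
  by rewrite (eq_sym i2) (negbTE i12) andbF => /esym/eqP; rewrite oner_eq0.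
- rewrite mul0r; case: eqP => // e; exfalso.
  by move: c1; rewrite -(KD c) -cE e -r1 [row i1 M]rowE KD !mxE !eqxx => /eqP; rewrite oner_eq0.
- rewrite mul0r; case: eqP => // e; exfalso.
  by move: c1; rewrite -(KD c) -cE e -r1 [row i1 M]rowE KD !mxE !eqxx => /eqP; rewrite oner_eq0.
rewrite subr0 mulr1; suff -> : eta = eta1 by rewrite eqxx.
rewrite cE -r1 rowE; congr (_ *m _); apply/rowP => l; rewrite [RHS]mxE eqxx /=.
have [->|l1] := eqVneq l i1; first by rewrite c1.
have [->|l2] := eqVneq l i2; first by rewrite c2.
have lb : b`_l \in b by exact: mem_nth.
have nrow (i : 'I_(size b)) (v : 'rV[R]_n) : v \in b -> v != b`_i -> (v *m D) 0 i = 0.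
  move=> vb; have lt := vb; rewrite -index_mem in lt.
  have vE : v = row (Ordinal lt) M by rewrite rM nth_index.
  move=> vi; rewrite vE [row _ M]rowE KD mxE.
  suff -> : (i == Ordinal lt) = false by rewrite andbF.
  by apply/negP => /eqP e; move: vi; rewrite vE rM e eqxx.
(* The remaining coordinates vanish: on [Z2] because [eta] is in [P], hence in the span of [W]; on
   [Z1] by the exchange argument of [swap_coord0]. *)
move: (lb); rewrite mem_cat => /orP[lZ2|].
  have eP : eta \in P by rewrite mem_filter cE; apply/andP; split; apply/YP.
  have [d dE] := span_row_seq (spZ1 _ eP).
  rewrite -(KD c) -cE dE mul_row_seq mulmx_suml summxE big1// => i _.
  rewrite -scalemxAl mxE nrow ?mulr0//.
    by rewrite mem_cat mem_nth ?orbT.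
  apply: contraTneq lZ2 => <-.
  move: b_uniq; rewrite cat_uniq => /and3P[_ /hasPn h _].
  by apply: h; exact: mem_nth.
rewrite mem_cat => /orP[lZ1|].
  have := sZ1 _ lZ1; rewrite mem_filter => /andP[/YP ol _].
  by apply: (swap_coord0 xi_uni ek sM fM i12 omE l1 l2 _ s so c1 c2); rewrite rM.
rewrite !inE => /orP[] /eqP e; exfalso.
  by move/eqP: l1; apply; apply: val_inj; rewrite /= -e index_uniq.
by move/eqP: l2; apply; apply: val_inj; rewrite /= -e index_uniq.
Qed.

End SeparatingPair.

(** * Orthogonality of the Fourier coefficients *)

Section Convolution.
Context {R : realType} {n p : nat}.
Variables (B : 'M[R]_n) (J : ('rV[R]_n -> R) -> R).
Hypotheses (Bunit : B \in unitmx) (mJ : is_mean B J).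
Implicit Types (y z : 'rV[R]_n -> 'rV[R]_p) (u v w eta zeta omega : 'rV[R]_n).

Lemma fcosN y eta : fcos J y (- eta) = fcos J y eta.
Proof.
by apply/rowP => a; rewrite !mxE; congr J; apply/funext => u; rewrite phaseNl cosN.
Qed.

Lemma fsinN y eta : smooth y -> lattice_per B y -> fsin J y (- eta) = - fsin J y eta.
Proof.
move=> sy py; apply/rowP => a; rewrite !mxE -(meanN mJ); last first.
  by apply: bddM => //; exact: (smooth_bdd Bunit).
by congr J; apply/funext => u; rewrite phaseNl sinN mulrN.
Qed.

Lemma fcos_derive y v eta : smooth y -> lattice_per B y -> is_dual B eta ->
  fcos J (fun u => 'D_v y u) eta = phase eta v *: fsin J y eta.
Proof.
move=> sy py de; apply/rowP => a; rewrite !mxE.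
by have [e _] := fourier_derive Bunit mJ v a sy py de; exact: e.
Qed.

Lemma fsin_derive y v eta : smooth y -> lattice_per B y -> is_dual B eta ->
  fsin J (fun u => 'D_v y u) eta = - phase eta v *: fcos J y eta.
Proof.
move=> sy py de; apply/rowP => a; rewrite !mxE mulNr.
by have [_ e] := fourier_derive Bunit mJ v a sy py de; exact: e.
Qed.

Lemma mean_dotv_mul y (b : 'rV[R]_p) (phi : 'rV[R]_n -> R) :
  smooth y -> lattice_per B y -> bdd phi ->
  J (fun u => dotv (y u) b * phi u) = \sum_a J (fun u => y u 0 a * phi u) * b 0 a.
Proof.
move=> sy py bphi; have by_ a : bdd (fun u => y u 0 a) by exact: (smooth_bdd Bunit).
rewrite (_ : (fun u => _) = (fun u => \sum_a b 0 a * (y u 0 a * phi u))); last first.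
  apply/funext => u; rewrite mulr_suml; apply: eq_bigr => a _.
  by ring.
rewrite (mean_sum mJ) => [|a]; last by apply: bddZ; exact: bddM.
by apply: eq_bigr => a _; rewrite [RHS]mulrC (meanZ mJ)//; exact: bddM.
Qed.

Lemma mean_dotv_fcos y b eta : smooth y -> lattice_per B y ->
  J (fun u => dotv (y u) b * cos (phase eta u)) = dotv (fcos J y eta) b.
Proof.
by move=> sy py; rewrite mean_dotv_mul//; apply: eq_bigr => a _; rewrite mxE.
Qed.

Lemma mean_dotv_fsin y b eta : smooth y -> lattice_per B y ->
  J (fun u => dotv (y u) b * sin (phase eta u)) = dotv (fsin J y eta) b.
Proof.
by move=> sy py; rewrite mean_dotv_mul//; apply: eq_bigr => a _; rewrite mxE.
Qed.

Lemma bdd_dotv y (b : 'rV[R]_p) : smooth y -> lattice_per B y -> bdd (fun u => dotv (y u) b).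
Proof.
move=> sy py; apply: bdd_sum => a; apply: bddM => //.
exact: (smooth_bdd Bunit).
Qed.

Variables (N : nat) (xi : 'I_N -> 'rV[R]_n) (y z : 'rV[R]_n -> 'rV[R]_p).
Hypotheses (y_smooth : smooth y) (y_per : lattice_per B y).
Hypotheses (z_smooth : smooth z) (z_per : lattice_per B z).
Hypothesis zE : forall u, z u =
  \sum_j (cos (phase (xi j) u) *: (2 *: fcos J z (xi j)) +
          sin (phase (xi j) u) *: (2 *: fsin J z (xi j))).

(** [conv_cos] is the real part, and [conv_sin] minus the imaginary part, of the complex bilinear
    product of the coefficients of [y] at [omega - eta] and of [z] at [eta]. *)
Let conv_cos omega eta := 
  dotv (fcos J y (omega - eta)) (fcos J z eta) -
  dotv (fsin J y (omega - eta)) (fsin J z eta).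
Let conv_sin omega eta := 
  dotv (fsin J y (omega - eta)) (fcos J z eta) +
  dotv (fcos J y (omega - eta)) (fsin J z eta).

(** Only [z] is expanded; each of its characters combines with the one at [omega], so the
    coefficients of [y] appear by definition and no product of two sums arises. *)
Lemma mean_dotv_conv_cos omega :
  J (fun u => dotv (y u) (z u) * cos (phase omega u)) =
  \sum_j (conv_cos omega (xi j) + conv_cos omega (- xi j)).
Proof.
rewrite (_ : (fun u => _) = (fun u => \sum_j (
    dotv (y u) (fcos J z (xi j)) * cos (phase (omega - xi j) u) +
    dotv (y u) (fcos J z (xi j)) * cos (phase (omega + xi j) u) +
    (dotv (y u) (fsin J z (xi j)) * sin (phase (omega + xi j) u) -
     dotv (y u) (fsin J z (xi j)) * sin (phase (omega - xi j) u))))); last first.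
  apply/funext => u; rewrite {1}zE dotv_sumr mulr_suml; apply: eq_bigr => j _.
  rewrite dotvDr !dotvZr !phaseDl !phaseNl cosB cosD sinB sinD; ring.
have by1 b eta : bdd (fun u => dotv (y u) b * cos (phase eta u)).
  by apply: bddM => //; exact: bdd_dotv.
have by2 b eta : bdd (fun u => dotv (y u) b * sin (phase eta u)).
  by apply: bddM => //; exact: bdd_dotv.
rewrite (mean_sum mJ) => [|j]; last by apply: bddD; [exact: bddD|exact: bddB].
apply: eq_bigr => j _.
rewrite (meanD mJ); [|exact: bddD|exact: bddB].
rewrite (meanD mJ)// (meanB mJ)// !mean_dotv_fcos// !mean_dotv_fsin//.
rewrite /conv_cos fcosN fsinN// opprK dotvNr; ring.
Qed.

Lemma mean_dotv_conv_sin omega :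
  J (fun u => dotv (y u) (z u) * sin (phase omega u)) =
  \sum_j (conv_sin omega (xi j) + conv_sin omega (- xi j)).
Proof.
rewrite (_ : (fun u => _) = (fun u => \sum_j (
    dotv (y u) (fcos J z (xi j)) * sin (phase (omega - xi j) u) +
    dotv (y u) (fcos J z (xi j)) * sin (phase (omega + xi j) u) +
    (dotv (y u) (fsin J z (xi j)) * cos (phase (omega - xi j) u) -
     dotv (y u) (fsin J z (xi j)) * cos (phase (omega + xi j) u))))); last first.
  apply/funext => u; rewrite {1}zE dotv_sumr mulr_suml; apply: eq_bigr => j _.
  rewrite dotvDr !dotvZr !phaseDl !phaseNl cosB cosD sinB sinD; ring.
have by1 b eta : bdd (fun u => dotv (y u) b * cos (phase eta u)).
  by apply: bddM => //; exact: bdd_dotv.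
have by2 b eta : bdd (fun u => dotv (y u) b * sin (phase eta u)).
  by apply: bddM => //; exact: bdd_dotv.
rewrite (mean_sum mJ) => [|j]; last by apply: bddD; [exact: bddD|exact: bddB].
apply: eq_bigr => j _.
rewrite (meanD mJ); [|exact: bddD|exact: bddB].
rewrite (meanD mJ)// (meanB mJ)// !mean_dotv_fcos// !mean_dotv_fsin//.
rewrite /conv_sin fcosN fsinN// opprK dotvNr; ring.
Qed.

End Convolution.

Section CoefficientRelations.
Context {R : realType} {n p : nat}.
Variables (B : 'M[R]_n) (J : ('rV[R]_n -> R) -> R).
Hypotheses (n_gt0 : (0 < n)%N) (Bunit : B \in unitmx) (mJ : is_mean B J).
Variables (x : 'rV[R]_n -> 'rV[R]_p) (lam : R).
Hypotheses (x_smooth : smooth x) (x_per : lattice_per B x) (x_isometric : isometric x).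
Hypothesis lam_gt0 : 0 < lam.
Hypothesis x_spec : forall eta, is_dual B eta -> 4 * pi ^+ 2 * dotv eta eta != lam ->
    fcos J x eta = 0 /\ fsin J x eta = 0.
Variables (N : nat) (xi : 'I_N -> 'rV[R]_n).
Hypothesis xi_all : enumerates_up_to_sign
  [set eta : 'rV[R]_n | is_dual B eta /\ 4 * pi ^+ 2 * dotv eta eta = lam] xi.
Hypothesis xi_uni : unimodular xi.

Let xiA j : is_dual B (xi j) /\ 4 * pi ^+ 2 * dotv (xi j) (xi j) = lam := xi_all.1 j.

Lemma signed_dual eta : signed xi eta -> is_dual B eta.
Proof. by case=> j [->|->]; [|apply: dualN]; exact: (xiA j).1. Qed.

Lemma signed_spec eta : is_dual B eta -> ~ signed xi eta ->
  fcos J x eta = 0 /\ fsin J x eta = 0.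
Proof.
move=> de ns; apply: x_spec => //; apply/eqP => le; apply: ns.
by have [j [hj _]] := xi_all.2 eta (conj de le); exists j.
Qed.

Lemma derive_expansion w u : 'D_w x u =
  \sum_j (cos (phase (xi j) u) *: (2 *: fcos J (fun u => 'D_w x u) (xi j)) +
          sin (phase (xi j) u) *: (2 *: fsin J (fun u => 'D_w x u) (xi j))).
Proof.
apply: (trig_expansion n_gt0 Bunit mJ lam_gt0 xi_all (y := fun u => 'D_w x u)).
- exact: smooth_derive.
- exact: latper_derive.
move=> eta de ne; have [c0 s0] := x_spec de ne.
rewrite (fcos_derive Bunit mJ w x_smooth x_per de).
rewrite (fsin_derive Bunit mJ w x_smooth x_per de).
by rewrite c0 s0 !scaler0.
Qed.

(** With [v] and [w] the covectors of [separating_pair], every term at [eta != eta1] vanishes. What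
    is left is [4 pi^2 * T eta1] times the number of occurrences of [eta1] among the [+- xi j],
    which is positive. *)
Lemma separated_sum_eq0 eta1 eta2 (T : 'rV[R]_n -> R) :
  signed xi eta1 -> signed xi eta2 -> eta1 + eta2 != 0 ->
  (forall eta, signed xi eta -> ~ signed xi (eta1 + eta2 - eta) -> T eta = 0) ->
  (forall v w, \sum_j
    (phase (eta1 + eta2 - xi j) v * phase (xi j) w * T (xi j) +
     phase (eta1 + eta2 - - xi j) v * phase (- xi j) w * T (- xi j)) = 0) ->
  T eta1 = 0.
Proof.
move=> s1 s2 nz T0; pose len := lam / (4 * pi ^+ 2).
have pi4 : 0 < 4 * pi ^+ 2 :> R by rewrite mulr_gt0// exprn_gt0// pi_gt0.
have len_gt0 : 0 < len by rewrite divr_gt0.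
have xi_len j : dotv (xi j) (xi j) = len.
  by rewrite /len -(xiA j).2 mulrAC mulfV ?mul1r// lt0r_neq0.
have [f [g fg]] := separating_pair xi_uni len_gt0 xi_len s1 s2 nz.
have term eta : signed xi eta ->
    phase (eta1 + eta2 - eta) g * phase eta f * T eta =
    4 * pi ^+ 2 * T eta1 * (eta == eta1)%:R.
  move=> se; have [so|no] := pselect (signed xi (eta1 + eta2 - eta)).
    rewrite /phase; transitivity (4 * pi ^+ 2 * T eta *
      (dotv eta f * dotv (eta1 + eta2 - eta) g)); first by ring.
    by rewrite fg//; case: eqP => [->//|_]; rewrite !mulr0.
  rewrite T0// mulr0; case: eqP => [e|_]; last by rewrite mulr0.
  by case: no; rewrite e addrAC subrr add0r.
move=> /(_ g f); under eq_bigr => j _.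
  rewrite term; last by exists j; left.
  rewrite term; last by exists j; right.
  rewrite -mulrDr -natrD.
  over.
rewrite -mulr_sumr -natr_sum => /eqP; rewrite mulf_eq0 mulf_eq0 (gt_eqF pi4) /=.
move=> /orP[/eqP//|]; rewrite pnatr_eq0 sum_nat_eq0 => /forallP h.
by case: s1 => j [e|e]; have := h j; rewrite e eqxx ?addn1// addn_eq0 andbF.
Qed.

(** The two equations are the real and imaginary parts of the vanishing of the bilinear product of
    the coefficients at [eta1] and [eta2]. They hold because [dotv ('D_v x u) ('D_w x u)] is
    constant in [u], so its coefficient at [omega != 0] is 0 for all [v] and [w]. *)
Lemma coef_relations eta1 eta2 : signed xi eta1 -> signed xi eta2 ->
  eta1 + eta2 != 0 ->
  dotv (fsin J x eta2) (fsin J x eta1) = dotv (fcos J x eta2) (fcos J x eta1) /\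
  dotv (fcos J x eta2) (fsin J x eta1) + dotv (fsin J x eta2) (fcos J x eta1) = 0.
Proof.
move=> s1 s2 nz; set omega := eta1 + eta2.
have e2 : eta2 = omega - eta1 by rewrite /omega addrAC subrr add0r.
have dom : is_dual B omega by apply: dualD; exact: signed_dual.
have sD v := smooth_derive v x_smooth; have pD v := latper_derive v x_per.
have dsub eta : signed xi eta -> is_dual B (omega - eta).
  by move=> se; apply: dualD => //; apply: dualN; exact: signed_dual.
have cstE v w (phi : 'rV[R]_n -> R) : bdd phi -> J phi = 0 ->
    J (fun u => dotv ('D_v x u) ('D_w x u) * phi u) = 0.
  move=> bphi phi0; under eq_fun do rewrite (isometric_dotv x_smooth x_isometric).
  by rewrite (meanZ mJ)// phi0 mulr0.
have [c0 s0] := mean_trig Bunit mJ dom; rewrite (negbTE nz) in c0.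
have sj j : signed xi (xi j) by exists j; left.
have sNj j : signed xi (- xi j) by exists j; right.
split.
  (* Each derivative multiplies a coefficient by [i] times a phase, so the two together give minus
     the real part of the product. *)
  pose T eta := dotv (fsin J x (omega - eta)) (fsin J x eta) -
    dotv (fcos J x (omega - eta)) (fcos J x eta).
  suff : T eta1 = 0 by rewrite /T -e2 => /eqP; rewrite subr_eq0 => /eqP.
  apply: (separated_sum_eq0 s1 s2 nz) => [eta se ns|v w].
    by have [c s] := signed_spec (dsub _ se) ns; rewrite /T c s !dotv0l subrr.
  rewrite -[RHS](cstE v w (fun u => cos (phase omega u)) (bdd_cos _) c0).
  rewrite (mean_dotv_conv_cos Bunit mJ (sD v) (pD v) (sD w) (pD w) (derive_expansion w)).
  have conv eta : signed xi eta -> phase (omega - eta) v * phase eta w * T eta =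
      dotv (fcos J (fun u => 'D_v x u) (omega - eta)) (fcos J (fun u => 'D_w x u) eta) -
      dotv (fsin J (fun u => 'D_v x u) (omega - eta)) (fsin J (fun u => 'D_w x u) eta).
    move=> se; have de := signed_dual se; have do_ := dsub _ se.
    rewrite (fcos_derive Bunit mJ v x_smooth x_per do_) (fcos_derive Bunit mJ w x_smooth x_per de).
    rewrite (fsin_derive Bunit mJ v x_smooth x_per do_) (fsin_derive Bunit mJ w x_smooth x_per de).
    by rewrite !dotvZl !dotvZr /T; ring.
  by apply: eq_bigr => j _; congr (_ + _); exact: conv.
pose T eta := dotv (fcos J x (omega - eta)) (fsin J x eta) +
  dotv (fsin J x (omega - eta)) (fcos J x eta).
suff : T eta1 = 0 by rewrite /T -e2.
apply: (separated_sum_eq0 s1 s2 nz) => [eta se ns|v w].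
  by have [c s] := signed_spec (dsub _ se) ns; rewrite /T c s !dotv0l addr0.
apply/eqP; rewrite -oppr_eq0 -sumrN; apply/eqP.
rewrite -[RHS](cstE v w (fun u => sin (phase omega u)) (bdd_sin _) s0).
rewrite (mean_dotv_conv_sin Bunit mJ (sD v) (pD v) (sD w) (pD w) (derive_expansion w)).
have conv eta : signed xi eta -> - (phase (omega - eta) v * phase eta w * T eta) =
    dotv (fsin J (fun u => 'D_v x u) (omega - eta)) (fcos J (fun u => 'D_w x u) eta) +
    dotv (fcos J (fun u => 'D_v x u) (omega - eta)) (fsin J (fun u => 'D_w x u) eta).
  move=> se; have de := signed_dual se; have do_ := dsub _ se.
  rewrite (fcos_derive Bunit mJ v x_smooth x_per do_) (fcos_derive Bunit mJ w x_smooth x_per de).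
  rewrite (fsin_derive Bunit mJ v x_smooth x_per do_) (fsin_derive Bunit mJ w x_smooth x_per de).
  by rewrite !dotvZl !dotvZr /T; ring.
by apply: eq_bigr => j _; rewrite opprD; congr (_ + _); exact: conv.
Qed.

(** For [i != j] the relations for [(xi j, xi i)] and [(xi j, - xi i)] differ by the sign of the
    sine coefficient of [xi i], and adding or subtracting them separates the products. For [i = j]
    only the first pair is available; it gives equal norms and orthogonality. *)
Lemma coef_orthogonal i j :
  [/\ dotv (fcos J x (xi i)) (fcos J x (xi j)) =
        (i == j)%:R * dotv (fcos J x (xi i)) (fcos J x (xi i)),
      dotv (fsin J x (xi i)) (fsin J x (xi j)) =
        (i == j)%:R * dotv (fcos J x (xi i)) (fcos J x (xi i)) &
      dotv (fcos J x (xi i)) (fsin J x (xi j)) = 0].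
Proof.
have sj k : signed xi (xi k) by exists k; left.
have sNj k : signed xi (- xi k) by exists k; right.
have [eq1 eq2] := xi_sign_inj lam_gt0 xi_all j i.
have nzp : xi j + xi i != 0 by rewrite addr_eq0 eq2.
have [r1 r2] := coef_relations (sj j) (sj i) nzp.
have [e|ne] := eqVneq i j.
  subst j; rewrite mul1r; split=> //.
  by move: r2; rewrite dotvC -mulr2n => /eqP; rewrite mulrn_eq0 dotvC => /eqP.
have nzm : xi j + - xi i != 0 by rewrite subr_eq0 eq1 eq_sym.
have [] := coef_relations (sj j) (sNj i) nzm.
rewrite fcosN (fsinN Bunit mJ _ x_smooth x_per) !dotvNl => r3 r4.
by rewrite mul0r; split; lra.
Qed.

End CoefficientRelations.

(** * Homogeneity *)

Section Form.
Context {R : realType} {n p N : nat}.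
Variables (xi : 'I_N -> 'rV[R]_n) (A C : 'I_N -> 'rV[R]_p).
Variable x : 'rV[R]_n -> 'rV[R]_p.
Hypothesis xE : forall u,
  x u = \sum_j (cos (phase (xi j) u) *: A j + sin (phase (xi j) u) *: C j).
Hypothesis AA : forall i j, dotv (A i) (A j) = (i == j)%:R * dotv (A i) (A i).
Hypothesis CC : forall i j, dotv (C i) (C j) = (i == j)%:R * dotv (A i) (A i).
Hypothesis AC : forall i j, dotv (A i) (C j) = 0.
Hypothesis x_full : linearly_full x.

Lemma homogeneous_form_of_orthogonal :
  (exists k, p = k + k)%N /\ homogeneous_form xi x.
Proof.
(* [C j] has the norm of [A j], so both vanish outside [K], and both are normalised by the same
   [c j]. *)
pose K := [set j | A j != 0]%SET.
pose c j := Num.sqrt (dotv (A j) (A j)).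
have Kc j : j \in K -> 0 < c j.
  by rewrite inE => Aj; rewrite sqrtr_gt0 lt0r dotvv_ge0 dotvv_eq0 Aj.
have c2 j : c j * c j = dotv (A j) (A j) by rewrite -expr2 sqr_sqrtr// dotvv_ge0.
pose QA : 'M[R]_(#|K|, p) := \matrix_k ((c (enum_val k))^-1 *: A (enum_val k)).
pose QC : 'M[R]_(#|K|, p) := \matrix_k ((c (enum_val k))^-1 *: C (enum_val k)).
pose Q := col_mx QA QC.
have rows (F G : 'I_N -> 'rV[R]_p) (k l : 'I_#|K|) :
    ((\matrix_k ((c (enum_val k))^-1 *: F (enum_val k))) *m
     (\matrix_k ((c (enum_val k))^-1 *: G (enum_val k)))^T) k l =
    (c (enum_val k))^-1 * ((c (enum_val l))^-1 * dotv (F (enum_val k)) (G (enum_val l))).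
  rewrite -dotvZr -dotvZl mxE; apply: eq_bigr => a _.
  by rewrite [X in X * _]mxE [X in _ * X]mxE [X in _ * X]mxE.
have norm1 (k l : 'I_#|K|) : (c (enum_val k))^-1 * ((c (enum_val l))^-1 *
    ((enum_val k == enum_val l)%:R * dotv (A (enum_val k)) (A (enum_val k)))) = (k == l)%:R.
  rewrite (inj_eq enum_val_inj); case: eqP => [<-|_]; last by rewrite mul0r !mulr0.
  have c0 : c (enum_val k) != 0 by rewrite lt0r_neq0// Kc// enum_valP.
  by rewrite mul1r -c2 mulrA -invfM mulVf// mulf_neq0.
have QQ : Q *m Q^T = 1%:M.
  rewrite tr_col_mx mul_col_row scalar_mx_block; congr block_mx; apply/matrixP => k l;
    rewrite rows [RHS]mxE.
  - by rewrite AA norm1.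
  - by rewrite AC !mulr0.
  - by rewrite dotvC AC !mulr0.
  - by rewrite CC norm1.
have xQ u : x u = exp_map xi K c u *m Q.
  rewrite /exp_map mul_row_col !mulmx_sum_row -big_split /= xE.
  rewrite (bigID (mem K)) /= [X in _ + X]big1 ?addr0 => [|j]; last first.
    rewrite inE negbK => /eqP Aj; rewrite Aj scaler0 add0r.
    have /eqP : dotv (C j) (C j) = 0 by rewrite CC Aj dotv0l mulr0.
    by rewrite dotvv_eq0 => /eqP ->; rewrite scaler0.
  rewrite big_enum_val; apply: eq_bigr => k _.
  have c0 : c (enum_val k) != 0 by rewrite lt0r_neq0// Kc// enum_valP.
  rewrite !rowK !mxE !scalerA; congr (_ *: _ + _ *: _).
    by rewrite mulrAC mulfV// mul1r.
  by rewrite mulrAC mulfV// mul1r.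
(* [Q^T *m Q] is the orthogonal projector onto the row space of [Q], which contains the image of
   [x]. Being of full rank and idempotent, it is the identity. *)
have full : row_full (Q^T *m Q).
  apply: x_full => u; rewrite xQ.
  apply: submx_trans (submxMl _ Q) _.
  by rewrite -[X in (X <= _)%MS]mul1mx -QQ -mulmxA submxMl.
have QtQ : Q^T *m Q = 1%:M.
  have /row_fullP[D DW] := full.
  rewrite -[LHS]mul1mx -DW -(mulmxA D) [Q^T *m Q *m (Q^T *m Q)]mulmxA.
  by rewrite -(mulmxA Q^T Q) QQ mulmx1.
split; last by exists K, c, Q.
(* The two identities for [Q] bound the rank from both sides. *)
exists #|K|; apply/eqP; rewrite eqn_leq; apply/andP; split.
  rewrite -{1}(mxrank1 R p) -QtQ (leq_trans (mxrankM_maxr _ _))//.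
  exact: rank_leq_row.
rewrite -{1}(mxrank1 R (#|K| + #|K|)) -QQ (leq_trans (mxrankM_maxl _ _))//.
exact: rank_leq_col.
Qed.

End Form.

(** * The image as an orbit of a torus *)

Section Torus.
Context {R : realType} {n p N : nat}.
Variables (B : 'M[R]_n) (xi : 'I_N -> 'rV[R]_n).
Hypotheses (Bunit : B \in unitmx) (xi_dual : forall j, is_dual B (xi j)).
Implicit Types u v : 'rV[R]_n.

Section Rotation.
Variable K : {set 'I_N}.

Definition cos_diag u : 'M[R]_#|K| := diag_mx (\row_k cos (phase (xi (enum_val k)) u)).
Definition sin_diag u : 'M[R]_#|K| := diag_mx (\row_k sin (phase (xi (enum_val k)) u)).

(** Multiplication by the characters [exp (i phase (xi_k) u)] on [C^#|K|], acting on row vectors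
    made of real parts followed by imaginary parts. *)
Definition rot_mx u : 'M[R]_(#|K| + #|K|) :=
  block_mx (cos_diag u) (sin_diag u) (- sin_diag u) (cos_diag u).

Lemma cos_diagD u v :
  cos_diag u *m cos_diag v - sin_diag u *m sin_diag v = cos_diag (u + v).
Proof.
apply/matrixP => i j; rewrite !mul_diag_mx !mxE phaseDr.
by case: eqP => [->|_]; rewrite ?mulr0n ?mulr0 ?subrr// !mulr1n cosD.
Qed.

Lemma sin_diagD u v :
  cos_diag u *m sin_diag v + sin_diag u *m cos_diag v = sin_diag (u + v).
Proof.
apply/matrixP => i j; rewrite !mul_diag_mx !mxE phaseDr.
by case: eqP => [->|_]; rewrite ?mulr0n ?mulr0 ?addr0// !mulr1n sinD addrC.
Qed.

Lemma rot_mxD u v : rot_mx (u + v) = rot_mx u *m rot_mx v.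
Proof.
rewrite /rot_mx mulmx_block mulmxN !mulNmx cos_diagD sin_diagD.
congr block_mx; last by rewrite [RHS]addrC cos_diagD.
by rewrite mulmxN -opprD [X in _ = - X]addrC sin_diagD.
Qed.

Lemma rot_mx0 : rot_mx 0 = 1%:M.
Proof.
rewrite scalar_mx_block /rot_mx; congr block_mx; apply/matrixP => i j;
  by rewrite !mxE /phase dotv0r mulr0 ?cos0 ?sin0 ?mul0rn ?oppr0.
Qed.

Lemma tr_rot_mx u : (rot_mx u)^T = rot_mx (- u).
Proof.
rewrite /rot_mx tr_block_mx linearN /= !tr_diag_mx.
have eN k : phase (xi k) (- u) = - phase (xi k) u by rewrite -scaleN1r phaseZr mulN1r.
by congr block_mx; apply/matrixP => i j; rewrite !mxE eN ?cosN ?sinN ?mulNrn ?opprK.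
Qed.

Lemma rot_mx_per : lattice_per B rot_mx.
Proof.
move=> u z.
have [ec es] : cos_diag (u + latv B z) = cos_diag u /\ sin_diag (u + latv B z) = sin_diag u.
  split; apply/matrixP => i j; rewrite !mxE;
  have [ec es] := latper_trig 0 (xi_dual (enum_val i));
  by have := ec u z; have := es u z; rewrite !addr0 => h1 h2; rewrite ?h1 ?h2.
by rewrite /rot_mx ec es.
Qed.

Lemma rot_mx_continuous i j : continuous (fun u => rot_mx u i j).
Proof.
have cc k l : continuous (fun u => cos_diag u k l).
  under eq_fun do rewrite !mxE; have [_|_] := eqVneq k l; last exact: cst_continuous.
  move=> u; apply: (@continuous_comp _ _ _ (phase (xi (enum_val k))) (@cos R)).
    exact: phase_continuous.
  exact: continuous_cos.
have cs k l : continuous (fun u => sin_diag u k l).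
  under eq_fun do rewrite !mxE; have [_|_] := eqVneq k l; last exact: cst_continuous.
  move=> u; apply: (@continuous_comp _ _ _ (phase (xi (enum_val k))) (@sin R)).
    exact: phase_continuous.
  exact: continuous_sin.
rewrite -(splitK i) -(splitK j); case: (fintype.split i) => k; case: (fintype.split j) => l /=;
  rewrite /rot_mx.
- by under eq_fun do rewrite block_mxEul; exact: cc.
- by under eq_fun do rewrite block_mxEur; exact: cs.
- under eq_fun do rewrite block_mxEdl mxE; move=> u; apply: continuousN; exact: cs.
- by under eq_fun do rewrite block_mxEdr; exact: cc.
Qed.

Lemma exp_map_rot_mx c u : exp_map xi K c u = exp_map xi K c 0 *m rot_mx u.
Proof.
rewrite /exp_map /rot_mx mul_row_block.
rewrite (_ : \row_k (c (enum_val k) * sin (2 * pi * dotv (xi (enum_val k)) 0)) = 0);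
  last first.
  by apply/rowP => k; rewrite !mxE dotv0r mulr0 sin0 mulr0.
rewrite !mul0mx !addr0; congr row_mx; apply/rowP => k;
  by rewrite mul_mx_diag !mxE dotv0r mulr0 cos0 mulr1.
Qed.

Lemma torus_rot_mx (Q : 'M[R]_(#|K| + #|K|, p)) :
  Q *m Q^T = 1%:M -> Q^T *m Q = 1%:M ->
  torus_subgroup [set Q^T *m rot_mx u *m Q | u in [set: 'rV[R]_n]].
Proof.
move=> QQ QtQ; pose g u := Q^T *m rot_mx u *m Q.
have gD u v : g (u + v) = g u *m g v.
  by rewrite /g rot_mxD !mulmxA -(mulmxA _ Q) QQ mulmx1.
have g0 : g 0 = 1%:M by rewrite /g rot_mx0 mulmx1.
have gT u : (g u)^T = g (- u) by rewrite /g !trmx_mul trmxK tr_rot_mx mulmxA.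
have gV u : g u *m g (- u) = 1%:M by rewrite -gD subrr.
have cQ i k : continuous (fun u => (Q^T *m rot_mx u) i k).
  under eq_fun do rewrite mxE; apply: continuous_sum => l v.
  apply: (@continuousM _ _ (fun=> Q^T i l) (fun u => rot_mx u l k)).
    exact: cst_continuous.
  exact: rot_mx_continuous.
have cg : continuous g.
  apply: continuous_mx => i j; under eq_fun do rewrite mxE.
  apply: continuous_sum => k v.
  apply: (@continuousM _ _ (fun u => (Q^T *m rot_mx u) i k) (fun=> Q k j)).
    exact: cQ.
  exact: cst_continuous.
split.
- by move=> _ [u _ <-]; rewrite gT gV.
- by exists 0.
- by move=> _ _ [u _ <-] [v _ <-]; exists (u + v) => //; exact: gD.
- move=> _ [u _ <-]; exists (- u) => //.
  have [gu _] := mulmx1_unit (gV u).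
  by rewrite -[LHS](mulKmx gu) gV mulmx1.
- by move=> _ _ [u _ <-] [v _ <-]; rewrite -!/(g _) -!gD addrC.
(* By periodicity the group is already the image of the compact unit box. *)
- rewrite (_ : [set _ | _ in _] = [set g (v *m B) | v in
    [set v : 'rV[R]_n | forall i, v ord0 i \in `[(0 : R), 1]]]).
    apply: continuous_compact; last exact: unit_box_compact.
    apply: continuous_subspaceT => v; apply: (@continuous_comp _ _ _ (mulmxr B) g).
      exact: mulmxr_continuous.
    exact: cg.
  apply/seteqP; split=> [_ [u _ <-]|_ [v _ <-]]; last by exists (v *m B).
  have [v [z [v01 ->]]] := lattice_reduce Bunit u.
  by exists v => [i|]; [rewrite /= in_itv; exact: v01|rewrite /g rot_mx_per].
(* The group is the union of its one-parameter subgroups, connected sets which share the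
   identity. *)
- rewrite (_ : [set _ | _ in _] = \bigcup_(u in [set: 'rV[R]_n])
    [set g (t *: u) | t in [set: R]]).
    apply: bigcup_connected.
      by exists (g 0) => u _; exists 0; rewrite ?scale0r.
    move=> u _; apply: connected_continuous_connected.
      by apply/connected_intervalP.
    apply: continuous_subspaceT => t.
    apply: (@continuous_comp _ _ _ (fun t : R => t *: u) g); last exact: cg.
    exact: scalel_continuous.
  apply/seteqP; split=> [_ [u _ <-]|_ [u _ [t _ <-]]]; last by exists (t *: u).
  exists u; first by [].
  by exists 1; [|exact: (congr1 g (scale1r u))].
Qed.

End Rotation.

Lemma homogeneous_of_form (x : 'rV[R]_n -> 'rV[R]_p) :
  homogeneous_form xi x -> homogeneous x.
Proof.
move=> [K [c [Q [_ QQ QtQ xQ]]]].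
exists [set Q^T *m rot_mx K u *m Q | u in [set: 'rV[R]_n]]; first exact: torus_rot_mx.
exists (x 0).
have e u : x u = x 0 *m (Q^T *m rot_mx K u *m Q).
  by rewrite !xQ exp_map_rot_mx !mulmxA -(mulmxA _ Q) QQ mulmx1.
apply/seteqP; split=> [_ [u _ <-]|_ [_ [u _ <-] <-]].
  exists (Q^T *m rot_mx K u *m Q).
    by exists u.
  by rewrite [RHS]e.
by exists u; [|exact: e].
Qed.

End Torus.

Theorem proposition2p7 (R : realType) (n m : nat) (n_gt0 : (0 < n)%N)
    (Lam : set 'rV[R]_n) (Lam_lattice : is_lattice Lam)
    (x : 'rV[R]_n -> 'rV[R]_m.+1)
    (x_smooth : smooth x) (x_periodic : lattice_periodic Lam x)
    (x_sphere : in_sphere x) (x_isometric : isometric x)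
    (x_minimal : minimal x) (x_full : linearly_full x)
    (N : nat) (xi : 'I_N -> 'rV[R]_n)
    (xi_all : enumerates_up_to_sign (eigen_covector Lam) xi)
    (xi_unimodular : unimodular xi) :
  [/\ odd m, homogeneous x & homogeneous_form xi x].
Proof.
have [B Bunit LamE] := Lam_lattice.
have x_per : lattice_per B x by move=> u z; apply: x_periodic; rewrite LamE; exists z.
have dualE eta : dual_lattice Lam eta <-> is_dual B eta.
  split=> [d z|d v]; first by apply: d; rewrite LamE; exists z.
  by rewrite LamE => -[z _ <-]; exact: d.
have [J mJ] := exists_mean B.
have lam_gt0 : 0 < n%:R :> R by rewrite ltr0n.
have {}xi_all : enumerates_up_to_sign
    [set eta : 'rV[R]_n | is_dual B eta /\ 4 * pi ^+ 2 * dotv eta eta = n%:R] xi.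
  rewrite (_ : [set _ | _] = eigen_covector Lam)//; apply/funext => eta.
  by apply/propext; split=> -[/dualE].
have x_eigen := takahashi n_gt0 Bunit x_smooth x_per x_sphere x_isometric x_minimal.
have x_spec eta : is_dual B eta -> 4 * pi ^+ 2 * dotv eta eta != n%:R ->
    fcos J x eta = 0 /\ fsin J x eta = 0.
  move=> de ne; split; apply/rowP => a; rewrite !mxE;
  by have [] := eigen_coef0 Bunit mJ x_smooth x_per x_eigen a de ne.
have xE := trig_expansion n_gt0 Bunit mJ lam_gt0 xi_all x_smooth x_per x_spec.
have orth i j :=
  coef_orthogonal n_gt0 Bunit mJ x_smooth x_per x_isometric lam_gt0 x_spec xi_all xi_unimodular i j.
pose A j := 2 *: fcos J x (xi j); pose C j := 2 *: fsin J x (xi j).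
have AA i j : dotv (A i) (A j) = (i == j)%:R * dotv (A i) (A i).
  by rewrite !dotvZl !dotvZr; have [-> _ _] := orth i j; ring.
have CC i j : dotv (C i) (C j) = (i == j)%:R * dotv (A i) (A i).
  by rewrite !dotvZl !dotvZr; have [_ -> _] := orth i j; ring.
have AC i j : dotv (A i) (C j) = 0.
  by rewrite !dotvZl !dotvZr; have [_ _ ->] := orth i j; rewrite !mulr0.
have [[k mk] form] := homogeneous_form_of_orthogonal (A := A) (C := C) xE AA CC AC x_full.
split=> //; last by apply: (homogeneous_of_form Bunit _ form) => j; exact: (xi_all.1 j).1.
by have := congr1 odd mk; rewrite addnn odd_double /= => /negbFE.
Qed.
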